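(* Let $L$ be a language consisting of relation symbols and unary function symbols equipped with a permutation group $\Gamma_L$ and let $\mathcal K$ be a free amalgamation class of finite $\Gamma_L$-structures. Then $\mathcal K$ has EPPA if and only if every $\mathbf A\in\mathcal K$ lies in a finite orbit of the action of $\Gamma_L$ on $\Gamma_L$-structures by relabelling. Moreover, if $\mathcal K$ has EPPA, then it has irreducible structure faithful coherent EPPA.
   Context: Structures. A language $L$ consists of relation symbols $R$ (of arity $a(R)\ge 1$) and function symbols $F$ (of arity $a(F)\ge 0$; $F$ is unary if $a(F)=1$). $L$ is equipped with a permutation group $\Gamma_L$ if $\Gamma_L$ is a group of permutations of $L$ mapping relation symbols to relation symbols and function symbols to function symbols and preserving arities. A $\Gamma_L$-structure $\mathbf A$ has a finite or countably infinite vertex set $A$, a relation $R_{\mathbf A}\subseteq A^{a(R)}$ for each relation symbol $R\in L$, and a function $F_{\mathbf A}\colon A^{a(F)}\to\mathcal P(A)$ (the power set of $A$) for each function symbol $F\in L$. It is finite if $A$ is finite. Maps. A homomorphism $f\colon\mathbf A\to\mathbf B$ is a pair $f=(f_L,f_A)$ with $f_L\in\Gamma_L$ and $f_A\colon A\to B$ such that, for all $R,F\in L$ and all tuples $\bar x$, $\bar x\in R_{\mathbf A}$ implies $f_A(\bar x)\in f_L(R)_{\mathbf B}$, and $f_A(F_{\mathbf A}(\bar x))\subseteq f_L(F)_{\mathbf B}(f_A(\bar x))$. It is an embedding if $f_A$ is injective, the implication is an equivalence and the inclusion is an equality. An isomorphism is an embedding with $f_A$ bijective; an automorphism is an isomorphism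 of a structure to itself. Maps compose componentwise (language parts and vertex parts). $\mathbf A$ is a substructure of $\mathbf B$ if $A\subseteq B$ and the pair ($\mathrm{id}_L$, inclusion) is an embedding. For an embedding $f\colon\mathbf A\to\mathbf B$, $f(\mathbf A)$ is the substructure of $\mathbf B$ with vertex set $f_A(A)$; for a vertex set $X$, $f(X)=f_A(X)$. Relabelling. For $g\in\Gamma_L$, $g\mathbf A$ is the $\Gamma_L$-structure on the vertex set $A$ with $R_{g\mathbf A}=(g^{-1}(R))_{\mathbf A}$ and $F_{g\mathbf A}=(g^{-1}(F))_{\mathbf A}$; this defines the action of $\Gamma_L$ by relabelling. Amalgamation. Given embeddings $\alpha_i\colon\mathbf A\to\mathbf B_i$ ($i=1,2$), an amalgamation of $\mathbf B_1,\mathbf B_2$ over $\mathbf A$ with respect to $\alpha_1,\alpha_2$ is a structure $\mathbf C$ with embeddings $\beta_i\colon\mathbf B_i\to\mathbf C$ such that $\beta_1\alpha_1=\beta_2\alpha_2$ (including language parts). It is strong if $\beta_1(B_1)\cap\beta_2(B_2)=\beta_1\alpha_1(A)$. A strong amalgamation is free if $C=\beta_1(B_1)\cup\beta_2(B_2)$ and whenever a tuple $\bar x$ of vertices of $\mathbf C$ contains vertices of both $\beta_1(B_1\setminus\alpha_1(A))$ and $\beta_2(B_2\setminus\alpha_2(A))$, then $\bar x$ is in no relation of $\mathbf C$ and $F_{\mathbf C}(\bar x)=\emptyset$ for every $F\in L$ of the corresponding arity. An amalgamation class is a class $\mathcal K$ of finite $\Gamma_L$-structures closed under isomorphism with: the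 hereditary property (if $\mathbf B\in\mathcal K$ and $\mathbf A$ embeds into $\mathbf B$ then $\mathbf A\in\mathcal K$), the joint embedding property (any two members of $\mathcal K$ embed into a common member of $\mathcal K$), and the amalgamation property (for all $\mathbf A,\mathbf B_1,\mathbf B_2\in\mathcal K$ and embeddings $\alpha_i\colon\mathbf A\to\mathbf B_i$ there is $\mathbf C\in\mathcal K$ which is an amalgamation of $\mathbf B_1,\mathbf B_2$ over $\mathbf A$ with respect to $\alpha_1,\alpha_2$). It is a free amalgamation class if $\mathbf C$ in the amalgamation property can always be chosen to be the free amalgamation. A structure is irreducible if it is not a free amalgamation of two of its proper substructures (over a common substructure, with respect to inclusions). EPPA. A partial automorphism of $\mathbf A$ is an isomorphism $f$ between substructures of $\mathbf A$; its language part $f_L\in\Gamma_L$ is part of the data, and $\mathrm{dom}(f)$, $\mathrm{range}(f)$ refer to its vertex part. An automorphism $\theta$ extends $f$ if $\theta$ has the same language part as $f$ and its vertex part extends that of $f$. A finite $\mathbf B$ is an EPPA-witness for a finite $\mathbf A$ if there is an embedding $\psi\colon\mathbf A\to\mathbf B$ such that every partial automorphism of $\psi(\mathbf A)$ extends to an automorphism of $\mathbf B$. It is coherent if moreover (for this $\psi$) one can choose, for each partial automorphism $f$ of $\psi(\mathbf A)$, an automorphism $\hat f$ of $\mathbf B$ extending $f$ so that $\widehat{gf}=\hat g\hat f$ whenever $\mathrm{range}(f)=\mathrm{dom}(g)$. It is irreducible structure faithful if (for this $\psi$) for every irreducible substructure $\mathbf C$ of $\mathbf B$ there is an automorphism $g$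 of $\mathbf B$ with $g(C)\subseteq\psi(A)$. A class $\mathcal K$ of finite $\Gamma_L$-structures has EPPA if every $\mathbf A\in\mathcal K$ has an EPPA-witness $\mathbf B\in\mathcal K$; it has irreducible structure faithful coherent EPPA if such $\mathbf B\in\mathcal K$ can always be chosen to be an irreducible structure faithful coherent EPPA-witness. *)

(* Defs.v *)
From mathcomp Require Import all_boot.
From mathcomp Require Import boolp classical_sets functions cardinality.

Set Implicit Arguments.
Unset Strict Implicit.
Unset Printing Implicit Defensive.

Local Open Scope classical_set_scope.

(* Symbols are indexed by their arity, so a tuple fed to a symbol of arity n is
   a function on 'I_n and arity-preserving permutations need no casts. *)
Record language := Language {
  rel_symbol : nat -> Type;
  fun_symbol : nat -> Type;
  rel_arity_gt0 : rel_symbol 0 -> False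
}.

(* A permutation of L that preserves arities and the kind of each symbol. *)
Record lperm (L : language) := LPerm {
  prel : forall n, rel_symbol L n -> rel_symbol L n;
  prelV : forall n, rel_symbol L n -> rel_symbol L n;
  prelK : forall n, cancel (@prel n) (@prelV n);
  prelVK : forall n, cancel (@prelV n) (@prel n);
  pfun : forall n, fun_symbol L n -> fun_symbol L n;
  pfunV : forall n, fun_symbol L n -> fun_symbol L n;
  pfunK : forall n, cancel (@pfun n) (@pfunV n);
  pfunVK : forall n, cancel (@pfunV n) (@pfun n)
}.

Definition lperm_id (L : language) : lperm L :=
  @LPerm L (fun _ => id) (fun _ => id) (fun _ _ => erefl) (fun _ _ => erefl)
           (fun _ => id) (fun _ => id) (fun _ _ => erefl) (fun _ _ => erefl).

Definition lperm_inv (L : language) (g : lperm L) : lperm L :=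
  LPerm (prelVK g) (prelK g) (pfunVK g) (pfunK g).

Definition lperm_comp (L : language) (g f : lperm L) : lperm L :=
  LPerm (fun n => can_comp (prelK g (n:=n)) (prelK f (n:=n)))
        (fun n => can_comp (prelVK f (n:=n)) (prelVK g (n:=n)))
        (fun n => can_comp (pfunK g (n:=n)) (pfunK f (n:=n)))
        (fun n => can_comp (pfunVK f (n:=n)) (pfunVK g (n:=n))).

Record perm_group (L : language) := PermGroup {
  pg_set : set (lperm L);
  pg_id : pg_set (lperm_id L);
  pg_comp : forall g f, pg_set g -> pg_set f -> pg_set (lperm_comp g f);
  pg_inv : forall g, pg_set g -> pg_set (lperm_inv g)
}.

(* What a structure with vertex set V consists of besides V.  Keeping it apart
   from V makes the relabelling orbit of a structure a set in the universe of
   its vertices. *)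
Record interpretation (L : language) (V : Type) := Interpretation {
  rel_of : forall n, rel_symbol L n -> set ('I_n -> V);
  fun_of : forall n, fun_symbol L n -> ('I_n -> V) -> set V
}.

Record structure (L : language) := Structure {
  vertex :> Type;
  vertex_countable : countable [set: vertex];
  interp :> interpretation L vertex
}.

Definition finite_structure (L : language) (A : structure L) : Prop :=
  finite_set [set: A].

Definition relabel_interp (L : language) (V : Type) (g : lperm L)
    (I : interpretation L V) : interpretation L V :=
  Interpretation
    (fun n R => rel_of I (prel (lperm_inv g) R))
    (fun n F => fun_of I (pfun (lperm_inv g) F)).

Definition relabel (L : language) (g : lperm L) (A : structure L) :
    structure L :=
  Structure (vertex_countable A) (relabel_interp g A).

(* All relabellings of A share the vertex set of A, so the orbit is recorded as
   a set of interpretations on it. *)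
Definition relabel_orbit (L : language) (G : perm_group L) (A : structure L) :
    set (interpretation L A) :=
  [set (interp (relabel g A) : interpretation L A) | g in pg_set G].
Arguments relabel_orbit {L} G A _.

Record smap (L : language) (A B : structure L) := SMap {
  lpart : lperm L;
  vpart : A -> B
}.

Definition smap_comp (L : language) (A B C : structure L)
    (g : smap B C) (f : smap A B) : smap A C :=
  SMap (lperm_comp (lpart g) (lpart f)) (vpart g \o vpart f).

Section Maps.
Variables (L : language) (G : perm_group L).

Definition is_hom (A B : structure L) (f : smap A B) : Prop :=
  [/\ pg_set G (lpart f),
      forall n (R : rel_symbol L n) (x : 'I_n -> A),
        rel_of A R x -> rel_of B (prel (lpart f) R) (vpart f \o x)
    & forall n (F : fun_symbol L n) (x : 'I_n -> A),
        vpart f @` fun_of A F x `<=`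
        fun_of B (pfun (lpart f) F) (vpart f \o x)].

Definition is_embedding (A B : structure L) (f : smap A B) : Prop :=
  [/\ is_hom f,
      injective (vpart f),
      forall n (R : rel_symbol L n) (x : 'I_n -> A),
        rel_of A R x <-> rel_of B (prel (lpart f) R) (vpart f \o x)
    & forall n (F : fun_symbol L n) (x : 'I_n -> A),
        vpart f @` fun_of A F x = fun_of B (pfun (lpart f) F) (vpart f \o x)].

Definition is_iso (A B : structure L) (f : smap A B) : Prop :=
  is_embedding f /\ bijective (vpart f).

Definition is_automorphism (A : structure L) (f : smap A A) : Prop := is_iso f.

End Maps.

(* A vertex set carries a substructure (i.e. the inclusion of the induced
   structure is an embedding) exactly when it is closed under the functions. *)
Record substructure (L : language) (B : structure L) := Substructure {
  sub_set : set B;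
  sub_closed : forall n (F : fun_symbol L n) (x : 'I_n -> B),
    (forall i, sub_set (x i)) -> fun_of B F x `<=` sub_set
}.

Lemma set_type_countable (T : Type) (X : set T) :
  countable [set: T] -> countable [set: X].
Proof.
move=> cT; rewrite (eq_countable (card_setT X)).
exact: sub_countable (subset_card_le (@subsetT _ X)) cT.
Qed.

Definition induced (L : language) (B : structure L) (S : substructure B) :
    structure L :=
  @Structure L (set_type (sub_set S))
    (set_type_countable (sub_set S) (vertex_countable B))
    (Interpretation
      (fun n R x => rel_of B R (val \o x))
      (fun n F x => [set y | fun_of B F (val \o x) (val y)])).

Coercion induced : substructure >-> structure.

Definition proper_substructure (L : language) (B : structure L)
    (S : substructure B) : Prop := sub_set S <> [set: B].

Definition inclusion (L : language) (B : structure L) (S : substructure B) :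
    smap S B :=
  @SMap L (induced S) B (lperm_id L) val.

Definition inclusion2 (L : language) (B : structure L) (S T : substructure B)
    (ST : sub_set S `<=` sub_set T) : smap S T :=
  @SMap L (induced S) (induced T) (lperm_id L) (subfun ST).

Section ImageSubstructure.
Variables (L : language) (G : perm_group L).

Lemma range_closed (A B : structure L) (f : smap A B) :
  is_embedding G f ->
  forall n (F : fun_symbol L n) (x : 'I_n -> B),
    (forall i, range (vpart f) (x i)) -> fun_of B F x `<=` range (vpart f).
Proof.
move=> [_ _ _ ff] n F x /(_ _)/cid2 xr.
have -> : x = vpart f \o (fun i => s2val (xr i)).
  by apply/funext => i /=; rewrite (s2valP' (xr i)).
rewrite -[F](pfunVK (lpart f)) -ff.
exact: image_subset.
Qed.

Definition image_substructure (A B : structure L) (f : smap A B)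
    (ef : is_embedding G f) : substructure B :=
  Substructure (range_closed ef).

End ImageSubstructure.

Section Amalgamation.
Variables (L : language) (G : perm_group L).

Definition is_amalgamation (A B1 B2 C : structure L)
    (a1 : smap A B1) (a2 : smap A B2) (b1 : smap B1 C) (b2 : smap B2 C) :
    Prop :=
  [/\ is_embedding G b1, is_embedding G b2 & smap_comp b1 a1 = smap_comp b2 a2].

Definition is_strong_amalgamation (A B1 B2 C : structure L)
    (a1 : smap A B1) (a2 : smap A B2) (b1 : smap B1 C) (b2 : smap B2 C) :
    Prop :=
  is_amalgamation a1 a2 b1 b2 /\
  range (vpart b1) `&` range (vpart b2) = range (vpart b1 \o vpart a1).

Definition is_free_amalgamation (A B1 B2 C : structure L)
    (a1 : smap A B1) (a2 : smap A B2) (b1 : smap B1 C) (b2 : smap B2 C) :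
    Prop :=
  [/\ is_strong_amalgamation a1 a2 b1 b2,
      [set: C] = range (vpart b1) `|` range (vpart b2)
    & forall n (x : 'I_n -> C),
        (exists i, (vpart b1 @` (~` range (vpart a1))) (x i)) ->
        (exists j, (vpart b2 @` (~` range (vpart a2))) (x j)) ->
        (forall R : rel_symbol L n, ~ rel_of C R x) /\
        (forall F : fun_symbol L n, fun_of C F x = set0)].

Definition irreducible (C : structure L) : Prop :=
  ~ exists (B1 B2 A : substructure C)
           (AB1 : sub_set A `<=` sub_set B1) (AB2 : sub_set A `<=` sub_set B2),
      [/\ proper_substructure B1, proper_substructure B2
        & is_free_amalgamation (inclusion2 AB1) (inclusion2 AB2)
            (inclusion B1) (inclusion B2)].

Variable K : structure L -> Prop.

Definition class_of_finite : Prop := forall A, K A -> finite_structure A.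

Definition iso_closed : Prop :=
  forall A B (f : smap A B), is_iso G f -> K A -> K B.

Definition hereditary : Prop :=
  forall A B (f : smap A B), is_embedding G f -> K B -> K A.

Definition joint_embedding : Prop :=
  forall A B, K A -> K B ->
    exists C (f : smap A C) (g : smap B C),
      [/\ K C, is_embedding G f & is_embedding G g].

Definition amalgamation_property : Prop :=
  forall A B1 B2 (a1 : smap A B1) (a2 : smap A B2),
    K A -> K B1 -> K B2 -> is_embedding G a1 -> is_embedding G a2 ->
    exists C (b1 : smap B1 C) (b2 : smap B2 C),
      K C /\ is_amalgamation a1 a2 b1 b2.

Definition free_amalgamation_property : Prop :=
  forall A B1 B2 (a1 : smap A B1) (a2 : smap A B2),
    K A -> K B1 -> K B2 -> is_embedding G a1 -> is_embedding G a2 ->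
    exists C (b1 : smap B1 C) (b2 : smap B2 C),
      K C /\ is_free_amalgamation a1 a2 b1 b2.

Definition amalgamation_class : Prop :=
  [/\ class_of_finite, iso_closed, hereditary, joint_embedding
    & amalgamation_property].

Definition free_amalgamation_class : Prop :=
  amalgamation_class /\ free_amalgamation_property.

End Amalgamation.

Section EPPA.
Variables (L : language) (G : perm_group L).

(* A partial automorphism of M is an isomorphism f : D -> E between
   substructures D, E of M.  Below M is itself a substructure of B, whence the
   two layers of val. *)
Definition extends (B : structure L) (M : substructure B)
    (D E : substructure M) (f : smap D E) (theta : smap B B) : Prop :=
  lpart theta = lpart f /\
  forall x : D, vpart theta (val (val x)) = val (val (vpart f x)).

Definition eppa_for (B : structure L) (M : substructure B) : Prop :=
  forall (D E : substructure M) (f : smap D E), is_iso G f ->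
    exists theta : smap B B, is_automorphism G theta /\ extends f theta.

Definition coherent_eppa_for (B : structure L) (M : substructure B) : Prop :=
  exists hat : forall D E : substructure M, smap D E -> smap B B,
    (forall (D E : substructure M) (f : smap D E), is_iso G f ->
       is_automorphism G (hat D E f) /\ extends f (hat D E f)) /\
    (forall (D E H : substructure M) (f : smap D E) (g : smap E H),
       is_iso G f -> is_iso G g ->
       hat D H (smap_comp g f) = smap_comp (hat E H g) (hat D E f)).

Definition irreducible_faithful_for (B : structure L) (M : substructure B) :
    Prop :=
  forall C : substructure B, irreducible G C ->
    exists g : smap B B, is_automorphism G g /\
      vpart g @` sub_set C `<=` sub_set M.

Definition eppa_witness (A B : structure L) : Prop :=
  [/\ finite_structure A, finite_structure B
    & exists (psi : smap A B) (epsi : is_embedding G psi),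
        eppa_for (image_substructure epsi)].

Definition isf_coherent_eppa_witness (A B : structure L) : Prop :=
  [/\ finite_structure A, finite_structure B
    & exists (psi : smap A B) (epsi : is_embedding G psi),
        [/\ eppa_for (image_substructure epsi),
            coherent_eppa_for (image_substructure epsi)
          & irreducible_faithful_for (image_substructure epsi)]].

Definition has_eppa (K : structure L -> Prop) : Prop :=
  forall A, K A -> exists B, K B /\ eppa_witness A B.

Definition has_isf_coherent_eppa (K : structure L -> Prop) : Prop :=
  forall A, K A -> exists B, K B /\ isf_coherent_eppa_witness A B.

End EPPA.

(* Main.v *)
Require Import Defs.
From mathcomp Require Import all_boot fingroup perm.
From mathcomp Require Import boolp classical_sets functions cardinality.

(** If every member of the class has an EPPA-witness, orbits are finite for a
    cheap reason.  There are no constants, so the empty map with any language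
    part g is a partial automorphism; a witness B of A therefore has an
    automorphism with any prescribed language part.  Moving A inside B by such
    an automorphism realises each relabelling of A as the structure pulled back
    from B along some function from A to B, and there are finitely many of
    those ([eppa_finite_orbit]).

    For the converse, fix A with a finite orbit, with vertex set V.  The witness
    is glued from copies of A.  The gluing pattern is a cover ([is_cover]): a
    finite set B, a map phi from V to B and a group of pairs (g, t) of a
    language part and a permutation of B.  The maps t o phi are charts; each of
    them carries a relabelled copy of A, and what makes the gluing legitimate is
    that two charts overlap in a partial isomorphism.  Three successive
    constructions produce the cover that is needed.

    - [base_is_cover]: vertices are pairs of a vertex x of A and a valuation,
      one bit for every set S of vertices and every copy of a relabelled A on V.
      For nonempty S, the bits of the chart at (S, copy) sum to 1 exactly when
      the copy agrees with A on S.  The group consists of permutations of V twisted by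
      bits of total sum zero on each S: the sums survive, so an element taking a
      part of the chart to another part preserves the structure there.  Vertices
      covering S only in part see no sum, which leaves the freedom to extend
      partial automorphisms.  Finiteness of the orbit makes this cover finite.
    - [coloured_is_cover] makes charts conformal ([conformal]): a set any two
      points of which share a chart lies in one chart.  Each vertex receives a
      colour for every set M; a set M inside no chart has only #|M| - 1
      colours, while points that share a chart have different colours, so the
      pigeonhole principle forbids such sets ([coloured_conformal]).
    - [closed_is_cover] remembers with each vertex the image of its closure
      under the functions, so that overlaps of charts become closed.  This works
      vertex by vertex because the functions are unary.

    Extensions of partial automorphisms are explicit at each stage and
    compose: bijections are continued by matching ranks ([extend_comp]), and
    twists are coboundaries.  This yields coherence.

    An irreducible structure inside the resulting witness has all its pairs of
    points in common charts, since otherwise the parts avoiding one or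
    the other of two points would decompose it freely; by conformality it
    lies in one chart, hence in a copy of A ([irreducible_charted]).  This is
    faithfulness.  It also puts the witness in the class: by induction on size,
    a structure embedded in it is either irreducible, hence embeds in A, or is
    the free amalgamation of smaller ones, and free amalgamations are unique
    up to isomorphism ([class_of_embedded]). *)

Set Implicit Arguments.
Unset Strict Implicit.
Unset Printing Implicit Defensive.

(** * Generalities *)

Lemma inj_surj_bijective (T U : Type) (f : T -> U) :
  injective f -> (forall y, exists x, f x = y) -> bijective f.
Proof.
move=> fI /choice[g gP]; exists g => // x.
by apply: fI; rewrite gP.
Qed.

Lemma image_set_inj (T U : Type) (f : T -> U) (A B : set T) :
  injective f -> (f @` A)%classic = (f @` B)%classic -> A = B.
Proof.
move=> fI; wlog suff sub : A B / (f @` A)%classic = (f @` B)%classic ->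
    (A `<=` B)%classic.
  by move=> e; apply/seteqP; split; apply: sub.
move=> e x Ax; have : (f @` B)%classic (f x) by rewrite -e; exists x.
by move=> [y By /fI <-].
Qed.

Lemma finite_enum (T : Type) (X : set T) : finite_set X ->
  exists n (e : 'I_n -> T), injective e /\ range e = X.
Proof.
move=> /finite_setP[n /card_set_bijP[f [fX fI fS]]].
have /choice[e eP] : forall i : 'I_n, exists x, X x /\ f x = i.
  by move=> i; have [x Xx fx] := fS i (ltn_ord i); exists x.
exists n, e; split=> [i j eij|].
  apply: val_inj; have [_ ei] := eP i; have [_ ej] := eP j.
  by rewrite /= -ei -ej eij.
apply/seteqP; split=> [_ [i _ <-]|x Xx]; first by have [] := eP i.
have fx : f x < n := fX x Xx.
exists (Ordinal fx) => //; have [Xe fe] := eP (Ordinal fx).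
by apply: fI => //; exact: mem_set.
Qed.

Lemma finite_enum_type (T : Type) : finite_set [set: T] ->
  exists n (e : 'I_n -> T), bijective e.
Proof.
move=> /finite_enum[n [e [eI eT]]]; exists n, e.
apply: inj_surj_bijective => // y.
have : [set: T]%classic y by [].
by rewrite -eT => -[i _ <-]; exists i.
Qed.

(** * Continuing partial bijections by rank *)

Section MkPerm.
Variable U : finType.

(** A total version of [perm], so that extensions can be written for all maps
    and not only for partial automorphisms. *)
Definition mkperm (f : U -> U) : {perm U} :=
  if pselect (injective f) is left fI then perm fI else 1%g.

Lemma mkpermE (f : U -> U) : injective f -> mkperm f =1 f.
Proof. by move=> fI x; rewrite /mkperm; case: pselect => // h; rewrite permE. Qed.

End MkPerm.

Section Extend.
Variable U : finType.
Implicit Types (col : U -> bool) (D : {set U}) (f : U -> U).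

Definition outside col D (b : bool) : {set U} :=
  [set y | (y \notin D) && (col y == b)].

(** Off D, a point goes to the point of the same rank in the corresponding
    colour class of the complement of f @: D.  Matching ranks, rather than
    choosing a continuation, is what makes continuations compose. *)
Definition extend col1 col2 D f (x : U) : U :=
  if x \in D then f x
  else nth x (enum (outside col2 (f @: D) (col1 x)))
             (index x (enum (outside col1 D (col1 x)))).

Lemma eq_extend col1 col2 D f f' :
  {in D, f =1 f'} -> extend col1 col2 D f = extend col1 col2 D f'.
Proof.
move=> ff'; apply/funext => x; rewrite /extend (eq_in_imset ff').
by case: ifP => // /ff'.
Qed.

Definition extendable col1 col2 D f : Prop :=
  [/\ {in D &, injective f}, {in D, forall x, col2 (f x) = col1 x}
    & #|[set x | col1 x]| = #|[set x | col2 x]|].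

Section Props.
Variables (col1 col2 : U -> bool) (D : {set U}) (f : U -> U).
Hypothesis fP : extendable col1 col2 D f.

(** The colour classes have equal sizes on both sides and f matches their parts
    inside D, so what remains outside can be matched as well. *)
Lemma card_outside b :
  #|outside col2 (f @: D) b| = #|outside col1 D b|.
Proof.
have [fI fcol ccol] := fP.
have split_card col (E : {set U}) :
    #|[set x | col x == b]| = #|[set x in E | col x == b]| + #|outside col E b|.
  rewrite -(cardsID E); congr (_ + _).
    by apply: eq_card => x; rewrite !inE andbC.
  by apply: eq_card => x; rewrite !inE.
have ceq : #|[set x | col1 x == b]| = #|[set x | col2 x == b]|.
  case: b {split_card}.
    rewrite (_ : [set x | _] = [set x | col1 x]).
      by rewrite ccol; apply: eq_card => x; rewrite !inE eqb_id.
    by apply/setP => x; rewrite !inE eqb_id.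
  have E col : [set x | col x == false] = ~: [set x | col x].
    by apply/setP => x; rewrite !inE eqbF_neg.
  by rewrite !E [LHS]cardsCs [RHS]cardsCs !finset.setCK ccol.
have fE : [set x in f @: D | col2 x == b] = f @: [set x in D | col1 x == b].
  apply/setP => y; rewrite !inE; apply/andP/imsetP.
    move=> [/imsetP[x xD ->] cx]; exists x => //.
    by rewrite inE xD -(fcol _ xD).
  move=> [x]; rewrite inE => /andP[xD cx] ->; split; first exact: imset_f.
  by rewrite fcol.
have cD : #|f @: [set x in D | col1 x == b]| = #|[set x in D | col1 x == b]|.
  apply: card_in_imset => x y; rewrite !inE => /andP[xD _] /andP[yD _].
  exact: fI.
have := split_card col2 (f @: D); rewrite -ceq (split_card col1 D) fE cD.
by move/eqP; rewrite eqn_add2l => /eqP->.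
Qed.

Lemma extend_lt x : x \notin D ->
  index x (enum (outside col1 D (col1 x))) <
  size (enum (outside col2 (f @: D) (col1 x))).
Proof.
move=> xD; rewrite -cardE card_outside cardE index_mem mem_enum inE xD.
by rewrite eqxx.
Qed.

Lemma extend_outside x : x \notin D ->
  extend col1 col2 D f x \in outside col2 (f @: D) (col1 x).
Proof.
by move=> xD; rewrite /extend (negPf xD) -mem_enum mem_nth // extend_lt.
Qed.

Lemma extend_col x : col2 (extend col1 col2 D f x) = col1 x.
Proof.
have [fI fcol ccol] := fP.
have [xD|/extend_outside] := boolP (x \in D); first by rewrite /extend xD fcol.
by rewrite inE => /andP[_ /eqP].
Qed.

Lemma extend_in x : x \in D -> extend col1 col2 D f x = f x.
Proof. by rewrite /extend => ->. Qed.

Lemma index_extend x : x \notin D ->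
  index (extend col1 col2 D f x) (enum (outside col2 (f @: D) (col1 x))) =
  index x (enum (outside col1 D (col1 x))).
Proof.
by move=> xD; rewrite /extend (negPf xD) index_uniq ?enum_uniq // extend_lt.
Qed.

Lemma mem_extend x : (extend col1 col2 D f x \in f @: D) = (x \in D).
Proof.
have [xD|/extend_outside] := boolP (x \in D).
  by rewrite extend_in ?imset_f.
by rewrite inE => /andP[/negPf].
Qed.

Lemma extend_inj : injective (extend col1 col2 D f).
Proof.
have [fI _ _] := fP; move=> x y exy.
have := mem_extend y; rewrite -exy mem_extend.
have [xD yD|xD /esym/negbT yD] := boolP (x \in D).
  by apply: fI => //; rewrite -!extend_in.
have cxy : col1 x = col1 y by rewrite -extend_col exy extend_col.
have := index_extend yD; rewrite -exy -cxy index_extend // => ixy.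
have xin : x \in enum (outside col1 D (col1 x)) by rewrite mem_enum inE xD /=.
rewrite -(nth_index x xin) ixy nth_index //.
by rewrite mem_enum inE yD cxy /=.
Qed.

End Props.

(** Continuations preserve ranks outside the domain, so following two of them
    preserves ranks too.  This is the source of coherence. *)
Lemma extend_comp col1 col2 col3 D f g :
  extendable col1 col2 D f -> extendable col2 col3 (f @: D) g ->
  extend col2 col3 (f @: D) g \o extend col1 col2 D f =1
  extend col1 col3 D (g \o f).
Proof.
move=> fP gP x /=; have [xD|xD] := boolP (x \in D).
  by rewrite /extend xD imset_f.
have yD : extend col1 col2 D f x \notin f @: D by rewrite (mem_extend fP).
rewrite [LHS]/extend (negPf yD) [RHS]/extend (negPf xD) (extend_col fP).
rewrite (index_extend fP) // imset_comp; apply: set_nth_default.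
by rewrite -cardE (card_outside gP) cardE (extend_lt fP).
Qed.

End Extend.

(** * Covers, and a first cover by parity of valuations *)

Section BaseCover.
Variables (L : language) (G : perm_group L) (V : finType).
Variable (I : interpretation L V).
Hypothesis L_unary : forall n, fun_symbol L n -> n = 1%N.
Implicit Types (g h : lperm L) (D S : {set V}) (f s : V -> V).

Definition closed_in D : Prop :=
  forall n (F : fun_symbol L n) (x : 'I_n -> V),
    (forall i, x i \in D) -> forall y, fun_of I F x y -> y \in D.

(** The values of functions are compared as whole sets, including their part
    outside D: the map s has to move all of F(x), not its trace on D.  This is
    what lets closed sets be carried to closed sets. *)
Definition agree_on g s D : Prop :=
  (forall n (R : rel_symbol L n) (x : 'I_n -> V), (forall i, x i \in D) ->
     rel_of I R x <-> rel_of I (prel g R) (s \o x)) /\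
  (forall n (F : fun_symbol L n) (x : 'I_n -> V), (forall i, x i \in D) ->
     (s @` fun_of I F x)%classic = fun_of I (pfun g F) (s \o x)).

Definition partial_aut g D f : Prop :=
  [/\ pg_set G g, closed_in D, {in D &, injective f} & agree_on g f D].

Lemma agree_onS g s D S : S \subset D -> agree_on g s D -> agree_on g s S.
Proof.
move=> /fintype.subsetP SD [aR aF]; split=> n X x xS.
  by apply: aR => i; apply: SD.
by apply: aF => i; apply: SD.
Qed.

Lemma eq_agree_on g f s D :
  closed_in D -> {in D, f =1 s} -> agree_on g f D -> agree_on g s D.
Proof.
move=> clD fs [aR aF].
have cE n (x : 'I_n -> V) : (forall i, x i \in D) -> s \o x = f \o x.
  by move=> xD; apply/funext => i /=; rewrite fs.
split=> n X x xD; rewrite cE //; first exact: aR.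
rewrite -aF //; apply/seteqP; split=> y [z zX <-]; exists z => //;
  by rewrite fs // (clD _ X x xD z zX).
Qed.

Lemma partial_aut_id : partial_aut (lperm_id L) [set: V] id.
Proof.
split=> //; first exact: pg_id.
by split=> n X x _ //; rewrite image_id.
Qed.

Lemma partial_aut_comp g h D f s :
  partial_aut g D f -> partial_aut h (f @: D) s ->
  partial_aut (lperm_comp h g) D (s \o f).
Proof.
move=> [Gg clD fI [aR aF]] [Gh _ sI [bR bF]]; split=> //.
- exact: pg_comp.
- move=> x y xD yD /= e; apply: fI => //; apply: sI e; exact: imset_f.
- split=> n X x xD /=.
    rewrite aR // bR //; first by move=> i /=; rewrite imset_f.
  rewrite -image_comp aF //.
  by rewrite bF // => i /=; rewrite imset_f.
Qed.

(** The pattern along which copies of I are glued: the maps t o phi with H g t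
    are charts, and [cover_overlap] makes overlaps of charts partial
    isomorphisms.  The permutation s there is total since [agree_on] speaks of
    values of functions outside the overlap.  A partial automorphism is given
    by a total map f that matters on D only, whence [cover_eq_hat]. *)
Record is_cover (B : finType) (H : lperm L -> {perm B} -> Prop) (phi : V -> B)
    (hat : lperm L -> {set V} -> (V -> V) -> {perm B}) : Prop := IsCover {
  cover_group : forall g t, H g t -> pg_set G g;
  cover_comp : forall g h t u, H g t -> H h u -> H (lperm_comp h g) (t * u)%g;
  cover_inv : forall g t, H g t -> H (lperm_inv g) t^-1%g;
  cover_inj : injective phi;
  cover_hat : forall g D f, partial_aut g D f -> H g (hat g D f);
  cover_hatE : forall g D f, partial_aut g D f ->
    {in D, forall x, hat g D f (phi x) = phi (f x)};
  cover_eq_hat : forall g D f s, {in D, f =1 s} -> hat g D f = hat g D s;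
  cover_hat_comp : forall g h D f s,
    partial_aut g D f -> partial_aut h (f @: D) s ->
    hat (lperm_comp h g) D (s \o f) = (hat g D f * hat h (f @: D) s)%g;
  cover_overlap : forall g t, H g t -> exists s : {perm V},
    (forall x y, t (phi x) = phi y -> y = s x) /\
    agree_on g s [set x | t (phi x) == phi (s x)]
}.

Section Base.
Variables (n : nat) (J : 'I_n -> interpretation L V) (i0 : 'I_n).
Hypotheses (JI : injective J) (Ji0 : J i0 = I).
Hypothesis Jclosed : forall g i, pg_set G g ->
  exists j, J j = relabel_interp g (J i).

Lemma relabelK g : cancel (@relabel_interp L V g) (relabel_interp (lperm_inv g)).
Proof.
move=> [r u]; rewrite /relabel_interp /=; congr Interpretation.
  by apply: functional_extensionality_dep => k; apply/funext => R; rewrite prelK.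
by apply: functional_extensionality_dep => k; apply/funext => F; rewrite pfunK.
Qed.

Definition relabel_idx g (i : 'I_n) : 'I_n :=
  odflt i [pick j | `[< J j = relabel_interp g (J i) >]].

Lemma relabel_idxE g i : pg_set G g ->
  J (relabel_idx g i) = relabel_interp g (J i).
Proof.
move=> Gg; rewrite /relabel_idx; case: pickP => [j /asboolP //|no].
by have [j /asboolP] := Jclosed i Gg; rewrite no.
Qed.

Lemma relabel_idx_comp g h i : pg_set G g -> pg_set G h ->
  relabel_idx (lperm_comp h g) i = relabel_idx h (relabel_idx g i).
Proof.
move=> Gg Gh; apply: JI; rewrite !relabel_idxE //; exact: pg_comp.
Qed.

Lemma relabel_idxK g i : pg_set G g ->
  relabel_idx (lperm_inv g) (relabel_idx g i) = i.
Proof.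
move=> Gg; apply: JI; rewrite !relabel_idxE ?relabelK //; exact: pg_inv.
Qed.

(** An index (S, (u, i)) stands for the structure J i, a relabelling of I,
    transported along the permutation u of V and looked at on S. *)
Definition local_copy : finType := ({set V} * ({perm V} * 'I_n))%type.

Definition transport g (s : {perm V}) (m : local_copy) : local_copy :=
  (s @: m.1, ((m.2.1 * s)%g, relabel_idx g m.2.2)).

Lemma transport_comp g h (s u : {perm V}) m : pg_set G g -> pg_set G h ->
  transport (lperm_comp h g) (s * u)%g m = transport h u (transport g s m).
Proof.
move=> Gg Gh; rewrite /transport /= relabel_idx_comp // mulgA -imset_comp.
by congr (_, _); apply: eq_imset => x; rewrite permM.
Qed.

Lemma transportK g (s : {perm V}) m : pg_set G g ->
  transport (lperm_inv g) s^-1%g (transport g s m) = m.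
Proof.
move=> Gg; case: m => S [u i]; rewrite /transport /= relabel_idxK // mulgK.
congr (_, _); rewrite -imset_comp -[RHS]imset_id; apply: eq_imset => x /=.
by rewrite permK.
Qed.

Lemma lperm_invK g : lperm_inv (lperm_inv g) = g.
Proof. by case: g. Qed.

Lemma transportVK g (s : {perm V}) m : pg_set G g ->
  transport g s (transport (lperm_inv g) s^-1%g m) = m.
Proof.
move=> /pg_inv Gg; rewrite -[in LHS](lperm_invK g) -[in X in transport _ X _](invgK s).
exact: transportK.
Qed.

Definition matches S (u : {perm V}) (X : interpretation L V) : Prop :=
  (forall k (R : rel_symbol L k) (x : 'I_k -> V), (forall i, x i \in S) ->
     rel_of I R x <-> rel_of X R (u^-1%g \o x)) /\
  (forall k (F : fun_symbol L k) (x : 'I_k -> V), (forall i, x i \in S) ->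
     fun_of I F x = (u @` fun_of X F (u^-1%g \o x))%classic).

Definition target (m : local_copy) : bool := `[< matches m.1 m.2.1 (J m.2.2) >].

(** As (g, s) carries I over S to I over s @: S, it preserves and reflects
    agreement of other structures with I. *)
Lemma target_transport g (s : {perm V}) m : pg_set G g -> agree_on g s m.1 ->
  target (transport g s m) = target m.
Proof.
move=> Gg; case: m => S [u i] [aR aF]; apply: asbool_equiv_eq => /=.
rewrite /= relabel_idxE //.
have invE k (x : 'I_k -> V) : (u * s)^-1%g \o (s \o x) = u^-1%g \o x.
  by apply/funext => j /=; rewrite invMg permM permK.
have lift k (x : 'I_k -> V) : (forall j, x j \in s @: S) ->
    exists2 y, x = s \o y & forall j, y j \in S.
  move=> xS; exists (s^-1%g \o x); first by apply/funext => j /=; rewrite permKV.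
  by move=> j /=; have /imsetP[z zS ->] := xS j; rewrite permK.
have imE (A : set V) : ((u * s)%g @` A = s @` (u @` A))%classic.
  by rewrite image_comp; apply: eq_imagel => y _ /=; rewrite permM.
split=> -[mR mF]; split=> k X x xS.
- rewrite aR // mR; last by move=> j /=; rewrite imset_f.
  by rewrite invE /= prelK.
- have /(image_set_inj (@perm_inj _ s)) : (s @` fun_of I X x =
      s @` (u @` fun_of (J i) X (u^-1%g \o x)))%classic.
    rewrite aF // mF /=; last by move=> j /=; rewrite imset_f.
    by rewrite invE /= pfunK imE.
  by [].
- have [y -> yS] := lift _ _ xS.
  by rewrite invE /= -mR // (aR _ _ _ yS) prelVK.
- have [y -> yS] := lift _ _ xS.
  rewrite invE /= imE -mF // aF //=.
  by rewrite pfunVK.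
Qed.

Lemma parity_pick S c : S != finset.set0 ->
  \big[addb/false]_(x in S) (c && (Some x == [pick y in S])) = c.
Proof.
move=> /set0Pn[z zS]; case: pickP => [y /= yS|/(_ z)]; last by rewrite zS.
rewrite (bigD1 y) //= eqxx andbT big1 ?addbF // => x /andP[_ /negPf xy].
by rewrite (inj_eq Some_inj) xy andbF.
Qed.

(** Valuations of the base chart: the required parity of an index is put on one
    chosen vertex of S. *)
Definition canonical (m : local_copy) (x : V) : bool :=
  target m && (Some x == [pick y in m.1]).

(** The bits of the vertices in D completed by bits outside D.  If S sticks out
    of D, one vertex outside D corrects the total to 0, so that the total
    depends on S, D and the target only.  It can then be compared along any
    bijection that respects D. *)
Definition standard D (m : local_copy) (x : V) : bool :=
  if x \in D then canonical m x
  else (\big[addb/false]_(y in m.1 :&: D) canonical m y) &&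
       (Some x == [pick y in m.1 :\: D]).

Lemma parity_canonical (m : local_copy) : m.1 != finset.set0 ->
  \big[addb/false]_(x in m.1) canonical m x = target m.
Proof. exact: parity_pick. Qed.

Lemma parity_standard D (m : local_copy) : m.1 != finset.set0 ->
  \big[addb/false]_(x in m.1) standard D m x = (m.1 \subset D) && target m.
Proof.
move=> m0; rewrite (big_setID D) /=.
have -> : \big[addb/false]_(x in m.1 :&: D) standard D m x =
    \big[addb/false]_(x in m.1 :&: D) canonical m x.
  by apply: eq_bigr => x; rewrite inE /standard => /andP[_ ->].
have [mD|mD] /= := boolP (m.1 \subset D).
  have /eqP -> : m.1 :\: D == finset.set0 by rewrite finset.setD_eq0.
  by rewrite big_set0 addbF (finset.setIidPl mD) parity_canonical.
set c := \big[_/_]_(_ in _) _.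
rewrite (eq_bigr (fun x => c && (Some x == [pick y in m.1 :\: D]))).
  by rewrite parity_pick ?addbb // finset.setD_eq0.
by move=> x; rewrite inE /standard => /andP[/negPf -> _].
Qed.

Definition valuation_vertex : finType := (V * {ffun local_copy -> bool})%type.

Definition twist g (s : {perm V}) (c : local_copy -> V -> bool)
    (p : valuation_vertex) : valuation_vertex :=
  (s p.1, [ffun m => let m' := transport (lperm_inv g) s^-1%g m in
                     p.2 m' (+) c m' p.1]).

Lemma twistE g (s : {perm V}) c p m : pg_set G g ->
  (twist g s c p).2 (transport g s m) = p.2 m (+) c m p.1.
Proof. by move=> Gg; rewrite ffunE /= transportK. Qed.

Lemma valuation_vertexP g (s : {perm V}) (p q : valuation_vertex) : pg_set G g ->
  p.1 = q.1 -> (forall m, p.2 (transport g s m) = q.2 (transport g s m)) -> p = q.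
Proof.
move=> Gg; case: p q => [x a] [y b] /= -> ab; congr (_, _).
by apply/ffunP => m; rewrite -(transportVK s m Gg).
Qed.

Lemma twist_inj g (s : {perm V}) c : pg_set G g -> injective (twist g s c).
Proof.
move=> Gg p q e; have e1 : p.1 = q.1.
  by move/(congr1 fst): e => /= /perm_inj.
apply: (valuation_vertexP (g := lperm_id L) (s := 1%g)) => // [|m].
  exact: pg_id.
move: (transport _ _ m) => {}m.
have := congr1 (fun r : valuation_vertex => r.2 (transport g s m)) e.
by rewrite !twistE // e1 => /addIb.
Qed.

(** Bits may be twisted only by c with total zero on each S: the sum over S of
    the valuations of a family of vertices lying over S is invariant, and this
    sum is where the structure on S is recorded. *)
Definition base_group g (t : {perm valuation_vertex}) : Prop :=
  pg_set G g /\ exists (s : {perm V}) (c : local_copy -> V -> bool),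
    (forall p, (t p).1 = s p.1 /\
       forall m, (t p).2 (transport g s m) = p.2 m (+) c m p.1) /\
    (forall m : local_copy, \big[addb/false]_(x in m.1) c m x = false).

Definition base_embed (x : V) : valuation_vertex :=
  (x, [ffun m => canonical m x]).

Definition base_perm D f : {perm V} := mkperm (extend xpredT xpredT D f).

(** The twist takes the standard bits of D to those of f @: D.  Being a
    coboundary, it is compatible with composition by construction. *)
Definition cocycle g D f (m : local_copy) (x : V) : bool :=
  standard D m x (+) standard (f @: D) (transport g (base_perm D f) m) (base_perm D f x).

Definition base_hat g D f : {perm valuation_vertex} :=
  mkperm (twist g (base_perm D f) (cocycle g D f)).

Lemma extendable_base g D f :
  partial_aut g D f -> extendable xpredT xpredT D f.
Proof. by case. Qed.

Lemma base_permE g D f : partial_aut g D f ->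
  base_perm D f =1 extend xpredT xpredT D f.
Proof. by move=> /extendable_base/extend_inj/mkpermE. Qed.

Lemma base_perm_in g D f : partial_aut g D f -> {in D, f =1 base_perm D f}.
Proof. by move=> pf x xD; rewrite (base_permE pf) extend_in. Qed.

Lemma base_perm_comp g h D f s :
  partial_aut g D f -> partial_aut h (f @: D) s ->
  base_perm D (s \o f) = (base_perm D f * base_perm (f @: D) s)%g.
Proof.
move=> pf ps; apply/permP => x.
rewrite permM (base_permE (partial_aut_comp pf ps)) (base_permE pf).
by rewrite (base_permE ps) -(extend_comp (extendable_base pf) (extendable_base ps)).
Qed.

Lemma eq_base_perm D f s : {in D, f =1 s} -> base_perm D f = base_perm D s.
Proof. by move=> fs; rewrite /base_perm (eq_extend _ _ fs). Qed.

Lemma target_hat g D f (m : local_copy) : partial_aut g D f -> m.1 \subset D ->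
  target (transport g (base_perm D f) m) = target m.
Proof.
move=> pf mD; have [Gg clD _ aD] := pf; apply: target_transport => //.
exact: agree_onS mD (eq_agree_on clD (base_perm_in pf) aD).
Qed.

(** The standard totals before and after agree: S lies in D exactly when its
    image lies in f @: D, and then f preserves the target parity. *)
Lemma parity_cocycle g D f (m : local_copy) : partial_aut g D f ->
  \big[addb/false]_(x in m.1) cocycle g D f m x = false.
Proof.
move=> pf; have [->|m0] := eqVneq m.1 finset.set0; first by rewrite big_set0.
rewrite big_split /= parity_standard //.
set m' := transport _ _ m; set s := base_perm D f.
have -> : \big[addb/false]_(x in m.1) standard (f @: D) m' (s x) =
    \big[addb/false]_(x in m'.1) standard (f @: D) m' x.
  by rewrite big_imset //= => x y _ _ /perm_inj.
rewrite parity_standard; last first.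
  by rewrite /m' /= -!card_gt0 card_imset ?card_gt0 //; exact: perm_inj.
have -> : (m'.1 \subset f @: D) = (m.1 \subset D).
  apply/fintype.subsetP/fintype.subsetP => sub x xm.
    rewrite -(mem_extend (extendable_base pf)) -(base_permE pf); apply: sub.
    exact: imset_f.
  have /imsetP[y ym ->] := xm; rewrite (base_permE pf).
  by rewrite (mem_extend (extendable_base pf)) sub.
by case: (boolP (m.1 \subset D)) => //= mD; rewrite target_hat // addbb.
Qed.

Lemma base_hatE g D f : partial_aut g D f ->
  base_hat g D f =1 twist g (base_perm D f) (cocycle g D f).
Proof. by move=> [Gg _ _ _]; apply: mkpermE; apply: twist_inj. Qed.

Lemma base_is_cover : is_cover base_group base_embed base_hat.
Proof.
split.
- by move=> g t [].
- move=> g h t u [Gg [s [c [tE c0]]]] [Gh [v [d [uE d0]]]].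
  split; first exact: pg_comp.
  exists (s * v)%g, (fun m x => c m x (+) d (transport g s m) (s x)); split.
    move=> p; rewrite permM; have [t1 t2] := tE p; have [u1 u2] := uE (t p).
    split; first by rewrite u1 t1 permM.
    by move=> m; rewrite transport_comp // u2 t2 t1 addbA.
  move=> m; rewrite big_split /= c0 addFb -[RHS](d0 (transport g s m)) big_imset //=.
  by move=> x y _ _ /perm_inj.
- move=> g t [Gg [s [c [tE c0]]]]; have Gg' := pg_inv Gg; split=> //.
  exists s^-1%g, (fun m x => c (transport (lperm_inv g) s^-1%g m) (s^-1%g x)); split.
    move=> p; have [t1 t2] := tE (t^-1%g p); move: t1 t2.
    rewrite permKV => t1 t2; split; first by rewrite t1 permK.
    by move=> m; rewrite -[in p.2 m](transportVK s m Gg) t2 t1 permK -addbA addbb addbF.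
  move=> m; rewrite -[RHS](c0 (transport (lperm_inv g) s^-1%g m)) big_imset //=.
  by move=> x y _ _ /perm_inj.
- by move=> x y [].
- move=> g D f pf; have [Gg _ _ _] := pf; split=> //.
  exists (base_perm D f), (cocycle g D f); split; last first.
    by move=> m; rewrite (parity_cocycle m pf).
  by move=> p; rewrite (base_hatE pf); split=> // m; rewrite twistE.
- move=> g D f pf x xD; have [Gg _ _ _] := pf; rewrite (base_hatE pf).
  apply: (valuation_vertexP (g := g) (s := base_perm D f)) => //.
    by rewrite /= -(base_perm_in pf).
  move=> m; rewrite twistE // !ffunE /cocycle /standard xD.
  by rewrite -(base_perm_in pf) // imset_f // addbA addbb addFb.
- move=> g D f s fs; rewrite /base_hat /cocycle (eq_base_perm fs).
  by rewrite (eq_in_imset fs).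
- move=> g h D f s pf ps; have [Gg _ _ _] := pf; have [Gh _ _ _] := ps.
  have pc := partial_aut_comp pf ps; have [Gc _ _ _] := pc.
  apply/permP => p; rewrite permM; apply: etrans (base_hatE pc p) _.
  apply: etrans _ (esym (base_hatE ps _)); rewrite (base_hatE pf p).
  apply: (valuation_vertexP (s := base_perm D (s \o f)) Gc).
    by rewrite /= (base_perm_comp pf ps) permM.
  move=> m; rewrite twistE // (base_perm_comp pf ps) transport_comp // !twistE //=.
  rewrite /cocycle -addbA; congr addb.
  rewrite (base_perm_comp pf ps) transport_comp // permM imset_comp addbA.
  by rewrite -[in RHS](addbA (standard D m p.1)) addbb addbF.
- move=> g t [Gg [s [c [tE c0]]]]; exists s; split.
    by move=> x y e; have [+ _] := tE (base_embed x); rewrite e.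
  set D := [set x | _].
  (* An empty overlap contains no tuples, as all symbols have positive arity;
     it is set apart because a sum over it could not record anything. *)
  have [D0|D0] := eqVneq D finset.set0.
    split=> k X x xD; have k0 : 0 < k.
    + by case: k X {x xD} => // /rel_arity_gt0.
    + by have := xD (Ordinal k0); rewrite D0 inE.
    + by rewrite (L_unary X).
    + by have := xD (Ordinal k0); rewrite D0 inE.
  (* I itself is a copy that matches I on D.  The sum over D of the bits of
     the chart at this index is thus 1, it is preserved by t, and so the
     relabelled and permuted I matches I on s @: D. *)
  pose m : local_copy := (D, (1%g, i0)).
  have tm : target m.
    have idE k (x : 'I_k -> V) : ((1^-1)%g : {perm V}) \o x = x.
      by apply/funext => i /=; rewrite invg1 perm1.
    have imE (A : set V) : ((1%g : {perm V}) @` A)%classic = A.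
      by rewrite -[RHS]image_id; apply: eq_imagel => y _; rewrite perm1.
    by apply/asboolP; rewrite /= Ji0; split=> k X x _; rewrite idE // imE.
  have : target (transport g s m).
    rewrite -parity_canonical; last first.
      by rewrite /= -!card_gt0 card_imset // ?card_gt0 //; exact: perm_inj.
    rewrite big_imset /=; last by move=> x y _ _ /perm_inj.
    rewrite (eq_bigr (fun x => canonical m x (+) c m x)).
      by rewrite big_split /= (c0 m) (parity_canonical (m := m)) // tm.
    move=> x; rewrite inE => /eqP e; have [_ /(_ m)] := tE (base_embed x).
    by rewrite e !ffunE.
  move=> /asboolP[]; rewrite /= relabel_idxE // Ji0 mul1g /= => mR mF.
  have sK k (x : 'I_k -> V) : s^-1%g \o (s \o x) = x.
    by apply/funext => i /=; rewrite permK.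
  split=> k X x xD.
    by rewrite (mR _ _ (s \o x)) ?sK ?prelK // => i; apply: imset_f.
  by rewrite (mF _ _ (s \o x)) ?sK ?pfunK // => i; apply: imset_f.
Qed.

End Base.
End BaseCover.

(** * Conformal covers by colouring *)

Section ConformalCover.
Variables (L : language) (G : perm_group L) (V : finType).
Variable (I : interpretation L V).
Implicit Types (g h : lperm L) (D S : {set V}) (f s : V -> V).

Definition charted (B : finType) (H : lperm L -> {perm B} -> Prop)
    (phi : V -> B) (X : {set B}) : Prop :=
  exists g t, H g t /\ X \subset [set t (phi v) | v : V].

(** Two-point sets include singletons, so every point of X is in some chart. *)
Definition conformal (B : finType) (H : lperm L -> {perm B} -> Prop)
    (phi : V -> B) : Prop :=
  forall X : {set B},
    {in X &, forall x y, charted H phi [set x; y]} -> charted H phi X.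

Section Conformal.
Variables (B : finType) (H : lperm L -> {perm B} -> Prop) (phi : V -> B).
Variable hat : lperm L -> {set V} -> (V -> V) -> {perm B}.
Hypothesis cov : is_cover G I H phi hat.

Lemma charted_imset g t (X : {set B}) : H g t ->
  charted H phi (t @: X) <-> charted H phi X.
Proof.
have imp h u (Y : {set B}) : H h u -> charted H phi Y -> charted H phi (u @: Y).
  move=> Hu [g' [t' [Ht' /fintype.subsetP YS]]].
  exists (lperm_comp h g'), (t' * u)%g; split; first exact: (cover_comp cov).
  apply/fintype.subsetP => _ /imsetP[y /YS/imsetP[v _ ->] ->].
  by apply/imsetP; exists v; rewrite ?permM.
move=> Ht; split; last exact: imp Ht.
move=> /(imp _ _ _ (cover_inv cov Ht)); rewrite -imset_comp.
by rewrite (eq_imset (g := id)) ?imset_id // => x /=; rewrite permK.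
Qed.

Lemma charted_embed : charted H phi [set phi v | v : V].
Proof.
have pid := partial_aut_id G I.
exists (lperm_id L), (hat (lperm_id L) [set: V] id); split.
  exact: (cover_hat cov pid).
apply/fintype.subsetP => _ /imsetP[v _ ->]; apply/imsetP; exists v => //.
by rewrite (cover_hatE cov pid) ?inE.
Qed.

Definition uncharted (X : {set B}) : bool := ~~ `[< charted H phi X >].

(** Points of B serve as colours, and points of the base chart use themselves;
    so the colour dropped when X lies in no chart is taken outside that
    chart. *)
Definition palette (X : {set B}) : {set B} :=
  [set x in X | ~~ (uncharted X &&
                    (Some x == [pick y in X :\: [set phi v | v : V]]))].

Lemma uncharted_pick X : uncharted X ->
  exists2 y, y \in X & [pick y in X :\: [set phi v | v : V]] = Some y.
Proof.
move=> /asboolPn Xbad; case: pickP => [y|no].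
  by rewrite inE => /andP[_ yX]; exists y.
case: Xbad; have [g [t [Ht sub]]] := charted_embed.
exists g, t; split=> //; apply: fintype.subset_trans sub.
by rewrite -finset.setD_eq0; apply/eqP/setP => y; rewrite no finset.in_set0.
Qed.

Lemma card_palette X : #|palette X| = #|X| - uncharted X.
Proof.
rewrite /palette; case: (boolP (uncharted X)) => [/uncharted_pick[y yX ->]|_].
  rewrite (cardsD1 y X) yX add1n subSS subn0; apply: eq_card => x.
  by rewrite !inE (inj_eq Some_inj) /= andbC.
by rewrite subn0; apply: eq_card => x; rewrite !inE andbT.
Qed.

Lemma palette_embed X v : (phi v \in palette X) = (phi v \in X).
Proof.
rewrite inE; case: (phi v \in X) => //=; case: (boolP (uncharted X)) => //= Xb.
case: pickP => // y; rewrite !inE (inj_eq Some_inj) => /andP[yV _].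
by apply: contraNneq yV => <-; apply: imset_f.
Qed.

Lemma uncharted_imset g t (X : {set B}) : H g t -> uncharted (t @: X) = uncharted X.
Proof. by move=> /(charted_imset X)/asbool_equiv_eq e; rewrite /uncharted e. Qed.

Lemma card_palette_imset g t (X : {set B}) : H g t -> #|palette (t @: X)| = #|palette X|.
Proof.
move=> Ht; rewrite !card_palette (uncharted_imset X Ht) card_imset //.
exact: perm_inj.
Qed.

Definition coloured_vertex : finType := (B * {ffun {set B} -> B})%type.

Definition recolour (t : {perm B}) (p : {set B} -> B -> B)
    (q : coloured_vertex) : coloured_vertex :=
  (t q.1, [ffun X : {set B} => let Y := t^-1%g @: X in p Y (q.2 Y)]).

Lemma imset_permK (t : {perm B}) (X : {set B}) : t^-1%g @: (t @: X) = X.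
Proof.
by rewrite -imset_comp -[RHS]imset_id; apply: eq_imset => x /=; rewrite permK.
Qed.

Lemma imset_permKV (t : {perm B}) (X : {set B}) : t @: (t^-1%g @: X) = X.
Proof. by rewrite -[in X in X @: _](invgK t) imset_permK. Qed.

Lemma recolourE (t : {perm B}) p q (X : {set B}) : (recolour t p q).2 (t @: X) = p X (q.2 X).
Proof. by rewrite ffunE /= imset_permK. Qed.

Lemma coloured_vertexP (t : {perm B}) (p q : coloured_vertex) :
  p.1 = q.1 -> (forall X : {set B}, p.2 (t @: X) = q.2 (t @: X)) -> p = q.
Proof.
case: p q => [x a] [y b] /= -> ab; congr (_, _).
by apply/ffunP => X; rewrite -(imset_permKV t X).
Qed.

Lemma recolour_inj t p : (forall X, injective (p X)) -> injective (recolour t p).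
Proof.
move=> pI q r e; apply: (coloured_vertexP (t := 1%g)) => [|X].
  by move/(congr1 fst): e => /= /perm_inj.
have -> : (1%g : {perm B}) @: X = X.
  by rewrite -[RHS]imset_id; apply: eq_imset => x; rewrite perm1.
have := congr1 (fun q : coloured_vertex => q.2 (t @: X)) e.
by rewrite !recolourE => /pI.
Qed.

(** At each set X the colours are permuted independently, as long as the palette
    of X is taken to that of its image. *)
Definition coloured_group g (u : {perm coloured_vertex}) : Prop :=
  exists (t : {perm B}) (p : {set B} -> {perm B}),
    [/\ H g t, forall (X : {set B}) x, (p X x \in palette (t @: X)) = (x \in palette X)
      & forall q, (u q).1 = t q.1 /\ forall X : {set B}, (u q).2 (t @: X) = p X (q.2 X)].

Definition coloured_embed (v : V) : coloured_vertex := (phi v, [ffun=> phi v]).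

Definition recolouring (t : {perm B}) (D : {set B}) (f : B -> B) (X : {set B}) :
    B -> B :=
  extend (mem (palette X)) (mem (palette (t @: X))) D f.

(** The recolouring at X has to follow t on the colours phi v with v in D, and is
    continued by rank, separately inside and outside the palette. *)
Definition coloured_hat g D f : {perm coloured_vertex} :=
  let t := hat g D f in mkperm (recolour t (recolouring t (phi @: D) t)).

Lemma extendable_palette g t (X D : {set B}) (f : B -> B) : H g t ->
  {in D &, injective f} ->
  {in D, forall x, (f x \in palette (t @: X)) = (x \in palette X)} ->
  extendable (mem (palette X)) (mem (palette (t @: X))) D f.
Proof.
move=> Ht fI fP; split=> //.
transitivity #|palette X|; first by apply: eq_card => x; rewrite inE.
by rewrite -(card_palette_imset X Ht); apply: eq_card => x; rewrite inE.
Qed.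

Lemma extendable_hat g D f (X : {set B}) : partial_aut G I g D f ->
  extendable (mem (palette X)) (mem (palette (hat g D f @: X))) (phi @: D)
    (hat g D f).
Proof.
move=> pf; apply: (extendable_palette (cover_hat cov pf)).
  by move=> x y _ _ /perm_inj.
move=> _ /imsetP[v vD ->]; rewrite (cover_hatE cov pf) // !palette_embed.
by rewrite -(cover_hatE cov pf) // mem_imset //; apply: perm_inj.
Qed.

Lemma coloured_hatE g D f : partial_aut G I g D f ->
  let t := hat g D f in
  coloured_hat g D f =1 recolour t (recolouring t (phi @: D) t).
Proof.
move=> pf t; apply: mkpermE; apply: recolour_inj => X.
exact/extend_inj/extendable_hat.
Qed.

Lemma recolour_group g t (D : {set B}) (f : {set B} -> B -> B)
    (u : {perm coloured_vertex}) : H g t ->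
  (forall X, extendable (mem (palette X)) (mem (palette (t @: X))) D (f X)) ->
  u =1 recolour t (fun X => recolouring t D (f X) X) ->
  coloured_group g u.
Proof.
move=> Ht fP uE; exists t, (fun X => mkperm (recolouring t D (f X) X)).
have pE X := mkpermE (extend_inj (fP X)).
split=> // [X x|q]; first by rewrite pE; exact: (extend_col (fP X)).
by split=> [|X]; rewrite uE // recolourE pE.
Qed.

Lemma coloured_is_cover :
  is_cover G I coloured_group coloured_embed coloured_hat.
Proof.
split.
- by move=> g u [t [p [/(cover_group cov)]]].
- move=> g h u v [t [p [Ht tW uE]]] [t' [p' [Ht' tW' vE]]].
  exists (t * t')%g, (fun X : {set B} => p X * p' (t @: X))%g.
  have imE (X : {set B}) : (t * t')%g @: X = t' @: (t @: X).
    by rewrite -imset_comp; apply: eq_imset => x; rewrite permM.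
  split; first exact: (cover_comp cov).
    by move=> X x; rewrite imE permM tW' tW.
  move=> q; have [u1 u2] := uE q; have [v1 v2] := vE (u q).
  by rewrite !permM; split=> [|X]; rewrite ?v1 ?u1 // imE v2 u2 permM.
- move=> g u [t [p [Ht tW uE]]].
  exists t^-1%g, (fun X : {set B} => (p (t^-1%g @: X))^-1)%g; split.
  + exact: (cover_inv cov).
  + by move=> X x; rewrite -tW permKV imset_permKV.
  + move=> q; have [] := uE (u^-1%g q); rewrite permKV => u1 u2.
    split; first by rewrite u1 permK.
    by move=> X; rewrite -[in q.2 X](imset_permKV t X) u2 permK.
- by move=> x y [/(cover_inj cov)].
- move=> g D f pf; have Ht := cover_hat cov pf.
  apply: (recolour_group Ht _ (coloured_hatE pf)) => X; exact: extendable_hat.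
- move=> g D f pf v vD; rewrite (coloured_hatE pf).
  apply: (coloured_vertexP (t := hat g D f)) => [|X].
    by rewrite /= (cover_hatE cov pf).
  rewrite recolourE !ffunE /recolouring extend_in ?imset_f //.
  by rewrite (cover_hatE cov pf).
- by move=> g D f s fs; rewrite /coloured_hat (cover_eq_hat cov _ fs).
- move=> g h D f s pf ps; have pc := partial_aut_comp pf ps.
  have tE := cover_hat_comp cov pf ps.
  apply/permP => q; rewrite permM; apply: etrans (coloured_hatE pc q) _.
  apply: etrans _ (esym (coloured_hatE ps _)); rewrite (coloured_hatE pf q).
  apply: (coloured_vertexP (t := hat (lperm_comp h g) D (s \o f))) => [|X].
    by rewrite /= tE permM.
  have imE (Y : {set B}) : hat (lperm_comp h g) D (s \o f) @: Y =
      hat h (f @: D) s @: (hat g D f @: Y).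
    by rewrite tE -imset_comp; apply: eq_imset => x; rewrite permM.
  have imD : phi @: (f @: D) = hat g D f @: (phi @: D).
    rewrite -!imset_comp; apply: eq_in_imset => v vD /=.
    by rewrite (cover_hatE cov pf).
  rewrite recolourE imE !recolourE /recolouring imE imD.
  have P1 := extendable_hat X pf.
  have P2 := extendable_hat (hat g D f @: X) ps; rewrite imD in P2.
  rewrite -[RHS]/((_ \o _) _) (extend_comp P1 P2); congr (extend _ _ _ _ _).
  by apply/funext => x; rewrite tE permM.
- move=> g u [t [p [Ht tW uE]]]; have [s [s1 s2]] := cover_overlap cov Ht.
  exists s; split=> [x y e|].
    by apply: s1; have [+ _] := uE (coloured_embed x); rewrite e.
  apply: agree_onS s2; apply/fintype.subsetP => x; rewrite !inE => /eqP e.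
  by have [+ _] := uE (coloured_embed x); rewrite e /= => ->.
Qed.

(** Inside one chart the colours at each X are a bijective image of the base
    points, with the palette at X marking exactly the points of X.  These
    facts involve two points only, hence hold for any set of points that
    pairwise share charts. *)
Lemma palette_pair (p q : coloured_vertex) :
  charted coloured_group coloured_embed [set p; q] ->
  [/\ p.1 = q.1 -> p = q, p.1 != q.1 -> forall X, p.2 X != q.2 X
    & forall X, (p.2 X \in palette X) = (p.1 \in X)].
Proof.
move=> [g [u [[t [r [Ht tW uE]]] /fintype.subsetP sub]]].
have /imsetP[v _ pE] := sub p (set21 _ _).
have /imsetP[w _ qE] := sub q (set22 _ _).
have [u1 u2] := uE (coloured_embed v); have [v1 v2] := uE (coloured_embed w).
rewrite -pE in u1 u2; rewrite -qE in v1 v2.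
split.
- by rewrite u1 v1 => /perm_inj/(cover_inj cov) vw; rewrite pE qE vw.
- rewrite u1 v1 => vw X; rewrite -(imset_permKV t X) u2 v2 !ffunE.
  by apply: contraNneq vw => /perm_inj /= ->.
- move=> X; rewrite -(imset_permKV t X) u2 tW ffunE palette_embed u1.
  by rewrite mem_imset //; apply: perm_inj.
Qed.

(** Points of Z lie over distinct points of B and have distinct colours at the
    projection M of Z, all of them in the palette of M.  If M were in no chart
    the palette would be too small.  So M lies in a chart t o phi, and the
    colours of Z are reached from those of the base chart by recolouring at each
    set along a continuation of the partial bijection they prescribe. *)
Lemma coloured_conformal : conformal coloured_group coloured_embed.
Proof.
move=> Z Zpair; pose M := fst @: Z.
have ZI : {in Z &, injective fst}.
  by move=> p q pZ qZ; have [+ _ _] := palette_pair (Zpair _ _ pZ qZ).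
have Zcol X p : p \in Z -> (p.2 X \in palette X) = (p.1 \in X).
  by move=> pZ; have [_ _ ->] := palette_pair (Zpair _ _ pZ pZ).
have ZcolI X : {in Z &, injective (fun p : coloured_vertex => p.2 X)}.
  move=> p q pZ qZ e; have [eq1 neq1 _] := palette_pair (Zpair _ _ pZ qZ).
  by have [/eq1 //|/neq1/(_ X)] := eqVneq p.1 q.1; rewrite e eqxx.
have Mok : ~~ uncharted M.
  apply/negP => Mbad; have [y yM _] := uncharted_pick Mbad.
  have : #|(fun p : coloured_vertex => p.2 M) @: Z| <= #|palette M|.
    apply/subset_leq_card/fintype.subsetP => _ /imsetP[p pZ ->].
    by rewrite Zcol // imset_f.
  rewrite card_palette Mbad (card_in_imset (ZcolI M)) (card_in_imset ZI).
  have : 0 < #|Z| by move/imsetP: yM => [p pZ _]; apply/card_gt0P; exists p.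
  by case: #|Z| => // k _; rewrite subSS subn0 ltnn.
move: Mok => /negPn/asboolP[g [t [Ht /fintype.subsetP sub]]].
pose D := t^-1%g @: M.
(* The point of Z over t y, unique by [ZI]. *)
pose lift y := [pick p in Z | p.1 == t y].
have liftE p : p \in Z -> lift (t^-1%g p.1) = Some p.
  move=> pZ; rewrite /lift permKV; case: pickP => [q /andP[qZ /eqP e]|/(_ p)].
    by rewrite (ZI _ _ qZ pZ e).
  by rewrite pZ eqxx.
pose f (X : {set B}) y := if lift y is Some p then p.2 (t @: X) else y.
have Df : forall y, y \in D -> exists2 p, p \in Z & y = t^-1%g p.1.
  by move=> y /imsetP[_ /imsetP[p pZ ->] ->]; exists p.
have fP X : extendable (mem (palette X)) (mem (palette (t @: X))) D (f X).
  apply: (extendable_palette Ht).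
    move=> _ _ /Df[p pZ ->] /Df[q qZ ->]; rewrite /f !liftE // => e.
    by rewrite (ZcolI _ _ _ pZ qZ e).
  move=> _ /Df[p pZ ->]; rewrite /f liftE // Zcol //.
  have /imsetP[v _ pv] : p.1 \in [set t (phi v) | v : V].
    by apply: sub; apply: imset_f.
  by rewrite pv permK palette_embed mem_imset //; apply: perm_inj.
pose u := mkperm (recolour t (fun X => recolouring t D (f X) X)).
have uE : u =1 recolour t (fun X => recolouring t D (f X) X).
  by apply: mkpermE; apply: recolour_inj => X; exact: extend_inj.
exists g, u; split; first exact: recolour_group uE.
apply/fintype.subsetP => p pZ.
have /imsetP[v _ pv] : p.1 \in [set t (phi v) | v : V].
  by apply: sub; apply: imset_f.
apply/imsetP; exists v => //; rewrite uE.
apply: (coloured_vertexP (t := t)) => // X.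
have vE : phi v = t^-1%g p.1 by rewrite pv permK.
rewrite recolourE ffunE vE /recolouring extend_in.
  by rewrite /f liftE.
by rewrite imset_f // imset_f.
Qed.

End Conformal.
End ConformalCover.

(** * Covers whose charts overlap in closed sets *)

Section ClosedCover.
Variables (L : language) (G : perm_group L) (V : finType).
Variable (I : interpretation L V).
Implicit Types (g h : lperm L) (D S : {set V}) (f s : V -> V).

Definition hull (a : V) : {set V} :=
  [set y | `[< forall S, closed_in I S -> a \in S -> y \in S >]].

Lemma hull_min a S y : closed_in I S -> a \in S -> y \in hull a -> y \in S.
Proof. by move=> clS aS; rewrite inE => /asboolP; apply. Qed.

Lemma mem_hull a : a \in hull a.
Proof. by rewrite inE; apply/asboolP. Qed.

Lemma hull_closed a : closed_in I (hull a).
Proof.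
move=> n F x xcl y Fy; rewrite inE; apply/asboolP => S clS aS.
apply: (clS _ F x _ _ Fy) => i; exact: hull_min (xcl i).
Qed.

(** Although s is only known to be a partial isomorphism on the closure of a,
    it moves the value sets as a whole, so images and preimages of closed sets
    are closed there. *)
Lemma imset_hull g s a : injective s -> agree_on I g s (hull a) ->
  s @: hull a = hull (s a).
Proof.
move=> sI [_ aF]; apply/setP => y; apply/idP/idP => [/imsetP[{}y ya ->]|].
  rewrite inE; apply/asboolP => S clS saS.
  have clT : closed_in I [set z in hull a | s z \in S].
    move=> n F x xT z Fz; have xa i : x i \in hull a.
      by have := xT i; rewrite inE => /andP[].
    rewrite inE (hull_closed xa Fz) /=.
    apply: (clS n (pfun g F) (s \o x)) => [i|].
      by have := xT i; rewrite inE => /andP[].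
    by rewrite -aF //; exists z.
  have aT : a \in [set z in hull a | s z \in S] by rewrite inE mem_hull saS.
  by have := hull_min clT aT ya; rewrite inE => /andP[].
apply: hull_min; last exact/imset_f/mem_hull.
move=> n F x xs z.
have /choice[x' x'E] : forall i, exists v, v \in hull a /\ x i = s v.
  by move=> i; have /imsetP[v va ->] := xs i; exists v.
have -> : x = s \o x' by apply/funext => i; case: (x'E i).
have x'a i : x' i \in hull a by case: (x'E i).
rewrite -[F](pfunVK g) -aF // => -[v Fv <-].
exact/imset_f/(hull_closed x'a Fv).
Qed.

(** What the base copy needs in order to be a substructure of the glued
    structure: values of functions that come from another chart stay in it. *)
Definition closed_overlaps (B : finType) (H : lperm L -> {perm B} -> Prop)
    (phi : V -> B) : Prop :=
  forall g t a b, H g t -> t (phi a) = phi b ->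
    {in hull a, forall y, exists z, t (phi y) = phi z}.

Section Closing.
Variables (B : finType) (H : lperm L -> {perm B} -> Prop) (phi : V -> B).
Variable hat : lperm L -> {set V} -> (V -> V) -> {perm B}.
Hypothesis cov : is_cover G I H phi hat.

Definition closed_vertex : finType := (B * {set B})%type.

Definition closed_embed (v : V) : closed_vertex := (phi v, phi @: hull v).

Definition push (t : {perm B}) (q : closed_vertex) : closed_vertex :=
  (t q.1, t @: q.2).

Lemma push_comp t u : push (t * u)%g =1 push u \o push t.
Proof.
move=> q; rewrite /push /= permM -imset_comp; congr (_, _).
by apply: eq_imset => x; rewrite permM.
Qed.

Lemma push_inj t : injective (push t).
Proof. by move=> [x X] [y Y] [/perm_inj -> /(imset_inj (@perm_inj _ t)) ->]. Qed.

Definition closed_group g (u : {perm closed_vertex}) : Prop :=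
  exists2 t, H g t & u =1 push t.

Definition closed_hat g D f : {perm closed_vertex} := mkperm (push (hat g D f)).

Lemma closed_hatE g D f : closed_hat g D f =1 push (hat g D f).
Proof. by apply: mkpermE; exact: push_inj. Qed.

(** Once t carries phi @: hull a into the base chart, it is there a partial
    isomorphism onto the closure of the image of a. *)
Lemma push_embed g (t : {perm B}) a : H g t ->
  {in hull a, forall y, exists z, t (phi y) = phi z} ->
  exists b, push t (closed_embed a) = closed_embed b.
Proof.
move=> Ht clE; have [s [s1 s2]] := cover_overlap cov Ht.
have tE y : y \in hull a -> t (phi y) = phi (s y).
  by move=> /clE[z e]; rewrite e (s1 _ _ e).
exists (s a); rewrite /push /closed_embed /= tE ?mem_hull //; congr (_, _).
rewrite -(imset_hull (@perm_inj _ s) (agree_onS _ s2)).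
  by rewrite -!imset_comp; apply: eq_in_imset => y /tE.
by apply/fintype.subsetP => y ya; rewrite inE tE.
Qed.

Lemma closed_overlap : closed_overlaps closed_group closed_embed.
Proof.
move=> g u a b [t Ht uE]; rewrite uE => -[e1 e2] y ya.
have clE z : z \in hull a -> exists w, t (phi z) = phi w.
  move=> za; have : t (phi z) \in t @: (phi @: hull a) by do 2!apply: imset_f.
  by rewrite e2 => /imsetP[w _ ->]; exists w.
have [w yw] : exists w, push t (closed_embed y) = closed_embed w.
  by apply: push_embed Ht _ => z /(hull_min (@hull_closed a) ya)/clE.
by exists w; rewrite uE.
Qed.

Lemma closed_is_cover : is_cover G I closed_group closed_embed closed_hat.
Proof.
split.
- by move=> g u [t /(cover_group cov)].
- move=> g h u v [t Ht uE] [t' Ht' vE].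
  exists (t * t')%g; first exact: (cover_comp cov).
  by move=> q; rewrite permM uE vE push_comp.
- move=> g u [t Ht uE]; exists t^-1%g; first exact: (cover_inv cov).
  move=> q; apply: (@perm_inj _ u); rewrite permKV uE.
  by rewrite -[RHS]/((push t \o push t^-1%g) q) -push_comp mulVg; case: q =>
    x X; rewrite /push /= perm1 (eq_imset (g := id)) ?imset_id // => y; rewrite perm1.
- by move=> x y [/(cover_inj cov)].
- move=> g D f pf; exists (hat g D f); first exact: (cover_hat cov).
  exact: closed_hatE.
- move=> g D f pf v vD; rewrite closed_hatE.
  have tE := cover_hatE cov pf; have [Gg clD fI aD] := pf.
  rewrite /push /closed_embed /= tE //; congr (_, _).
  have vsub : hull v \subset D.
    by apply/fintype.subsetP => y; apply: hull_min.
  have [s [s1 s2]] := cover_overlap cov (cover_hat cov pf).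
  have fE y : y \in hull v -> f y = s y.
    by move=> /(fintype.subsetP vsub) yD; apply: s1; rewrite tE.
  rewrite fE ?mem_hull // -(imset_hull (@perm_inj _ s) (agree_onS _ s2)).
    rewrite -!imset_comp; apply: eq_in_imset => y yv /=.
    by rewrite tE ?fE // (fintype.subsetP vsub).
  apply/fintype.subsetP => y yv; rewrite inE tE ?fE //.
  exact: (fintype.subsetP vsub).
- by move=> g D f s fs; rewrite /closed_hat (cover_eq_hat cov _ fs).
- move=> g h D f s pf ps; apply/permP => q; rewrite permM !closed_hatE.
  by rewrite (cover_hat_comp cov pf ps) push_comp.
- move=> g u [t Ht uE]; have [s [s1 s2]] := cover_overlap cov Ht.
  exists s; split=> [x y|]; first by rewrite uE => -[/s1].
  apply: agree_onS s2; apply/fintype.subsetP => x.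
  by rewrite !inE uE => /eqP[-> _].
Qed.

(** For a set Z of points that pairwise share charts, the union of the closures
    remembered by them is also pairwise charted, hence lies in a chart t o phi of the
    original cover.  The closure remembered by each point of Z is then the
    closure of that point for this very chart, because two charts that both
    contain it match there by a partial isomorphism. *)
Lemma closed_conformal : conformal H phi -> conformal closed_group closed_embed.
Proof.
move=> conf Z Zpair; pose X : {set B} := \bigcup_(q in Z) q.2.
have Zin q : q \in Z -> q.1 \in q.2.
  move=> qZ; have [g [u [[t Ht uE] sub]]] := Zpair q q qZ qZ.
  have /imsetP[v _ ->] := fintype.subsetP sub q (set21 _ _).
  by rewrite uE /= imset_f // imset_f // mem_hull.
have [|g [t [Ht /fintype.subsetP sub]]] := conf X.
  move=> x y /bigcupP[p pZ xp] /bigcupP[q qZ yq].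
  have [g [u [[t Ht uE] /fintype.subsetP sub]]] := Zpair p q pZ qZ.
  have mem r z : r \in [set p; q] -> z \in r.2 -> z \in [set t (phi v) | v : V].
    move=> /sub/imsetP[v _ ->]; rewrite uE => /imsetP[_ /imsetP[w _ ->] ->].
    exact: imset_f.
  exists g, t; split=> //; apply/fintype.subsetP => z /set2P[] ->.
    by apply: mem xp; rewrite set21.
  by apply: mem yq; rewrite set22.
exists g, (mkperm (push t)).
have uE := mkpermE (@push_inj t).
split; first by exists t.
apply/fintype.subsetP => q qZ.
have [g' [u' [[t' Ht' uE'] sub']]] := Zpair q q qZ qZ.
have /imsetP[a _ qE] := fintype.subsetP sub' q (set21 _ _).
rewrite uE' in qE.
have [b bE] : exists b, push (t' * t^-1)%g (closed_embed a) = closed_embed b.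
  apply: push_embed (cover_comp cov Ht' (cover_inv cov Ht)) _ => y ya.
  have /imsetP[w _ yw] : t' (phi y) \in [set t (phi v) | v : V].
    apply: sub; apply/bigcupP; exists q => //; rewrite qE.
    by rewrite imset_f // imset_f.
  by exists w; rewrite permM yw permK.
apply/imsetP; exists b => //; rewrite uE -bE -[RHS]/((push t \o push _) _).
by rewrite -push_comp -mulgA mulVg mulg1 qE.
Qed.

End Closing.
End ClosedCover.

(** * The structure glued from the charts of a cover *)

Section Structures.
Variables (L : language) (G : perm_group L).

Lemma embeddingP (A B : structure L) (f : smap A B) :
  pg_set G (lpart f) -> injective (vpart f) ->
  (forall n (R : rel_symbol L n) (x : 'I_n -> A),
     rel_of A R x <-> rel_of B (prel (lpart f) R) (vpart f \o x)) ->
  (forall n (F : fun_symbol L n) (x : 'I_n -> A),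
     (vpart f @` fun_of A F x)%classic =
     fun_of B (pfun (lpart f) F) (vpart f \o x)) ->
  is_embedding G f.
Proof.
move=> fG fI fR fF; split=> //; split=> // n X x; first by move/fR.
by rewrite fF.
Qed.

Lemma inclusion_embedding (B : structure L) (S : substructure B) :
  is_embedding G (inclusion S).
Proof.
apply: embeddingP => /= [||//|n F x]; first exact: pg_id.
  exact: val_inj.
apply/seteqP; split=> [y [z Fz <-] //|y Fy].
have yS : sub_set S y.
  by apply: (sub_closed _ Fy) => i; have := valP (x i); rewrite inE.
by exists (SigSub (mem_set yS)).
Qed.

Lemma embedding_comp (A B C : structure L) (f : smap A B) (g : smap B C) :
  is_embedding G f -> is_embedding G g -> is_embedding G (smap_comp g f).
Proof.
move=> [[fG _ _] fI fR fF] [[gG _ _] gI gR gF]; apply: embeddingP => /=.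
- exact: pg_comp.
- exact: inj_comp.
- by move=> n R x; rewrite fR gR.
- by move=> n F x; rewrite -image_comp fF gF.
Qed.

End Structures.

Section Witness.
Variables (L : language) (G : perm_group L).
Hypothesis L_unary : forall n, fun_symbol L n -> n = 1%N.
Variables (V : finType) (I : interpretation L V).
Variables (B : finType) (H : lperm L -> {perm B} -> Prop) (phi : V -> B).
Variable hat : lperm L -> {set V} -> (V -> V) -> {perm B}.
Hypothesis cov : is_cover G I H phi hat.
Hypotheses (conf : conformal H phi) (clov : closed_overlaps I H phi).

Lemma unary_ord n (F : fun_symbol L n) (i j : 'I_n) : i = j.
Proof. by have n1 := L_unary F; subst n; rewrite !ord1. Qed.

Lemma unary_index n (F : fun_symbol L n) : exists i : 'I_n, forall j, j = i.
Proof.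
by have n1 := L_unary F; subst n; exists ord0 => j; rewrite ord1.
Qed.

(** Points in no chart would be irreducible substructures that no automorphism
    moves into the copy of A, so they are discarded. *)
Definition covered (b : B) : bool :=
  `[< exists g t v, H g t /\ b = t (phi v) >].

Definition witness_vertex : finType := {b : B | covered b}.

(** The chart t o phi, for (g, t) in H, carries the relabelling of I by g. *)
Definition witness_interp : interpretation L witness_vertex :=
  Interpretation
    (fun n R x => exists g t (y : 'I_n -> V),
       [/\ H g t, forall i, val (x i) = t (phi (y i))
         & rel_of I (prelV g R) y])
    (fun n F x => [set z | exists g t (y : 'I_n -> V) w,
       [/\ H g t, forall i, val (x i) = t (phi (y i)), val z = t (phi w)
         & fun_of I (pfunV g F) y w]]%classic).

Lemma countable_finType (T : finType) : countable [set: T].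
Proof. by apply: finite_set_countable; exact: finite_finset. Qed.

Definition witness : structure L :=
  Structure (countable_finType witness_vertex) witness_interp.

Lemma covered_chart g t v : H g t -> covered (t (phi v)).
Proof. by move=> Ht; apply/asboolP; exists g, t, v. Qed.

Lemma identity_chart : exists t, H (lperm_id L) t /\ forall v, t (phi v) = phi v.
Proof.
have pid := partial_aut_id G I; exists (hat (lperm_id L) [set: V] id).
by split=> [|v]; [exact: (cover_hat cov pid) | rewrite (cover_hatE cov pid)].
Qed.

Lemma covered_embed v : covered (phi v).
Proof. by have [t [/covered_chart Ht <-]] := identity_chart. Qed.

Definition source : structure L := Structure (countable_finType V) I.

Definition witness_embed : smap source witness :=
  @SMap L source witness (lperm_id L)
    (fun v => exist _ (phi v) (covered_embed v)).

Definition witness_act (t : {perm B}) (x : witness_vertex) : witness_vertex :=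
  insubd x (t (val x)).

Definition witness_aut g (t : {perm B}) : smap witness witness :=
  @SMap L witness witness g (witness_act t).

Lemma val_witness_act g t x : H g t -> val (witness_act t x) = t (val x).
Proof.
move=> Ht; rewrite val_insubd ifT //.
have /asboolP[h [u [v [Hu ->]]]] := valP x.
by rewrite -permM; apply: covered_chart (cover_comp cov Hu Ht).
Qed.

Lemma witness_act_comp g h t u : H g t -> H h u ->
  witness_act (t * u)%g =1 witness_act u \o witness_act t.
Proof.
move=> Ht Hu x; apply: val_inj.
by rewrite /= (val_witness_act _ (cover_comp cov Ht Hu)) (val_witness_act _ Hu)
  (val_witness_act _ Ht) permM.
Qed.

Lemma witness_actK g t : H g t -> cancel (witness_act t) (witness_act t^-1%g).
Proof.
move=> Ht x; apply: val_inj; have Hu := cover_inv cov Ht.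
by rewrite (val_witness_act _ Hu) (val_witness_act _ Ht) permK.
Qed.

Lemma witness_actVK g t : H g t -> cancel (witness_act t^-1%g) (witness_act t).
Proof.
move=> Ht x; apply: val_inj; have Hu := cover_inv cov Ht.
by rewrite (val_witness_act _ Ht) (val_witness_act _ Hu) permKV.
Qed.

Lemma witness_act_rel g t n (R : rel_symbol L n) x : H g t ->
  rel_of witness R x -> rel_of witness (prel g R) (witness_act t \o x).
Proof.
move=> Ht [h [u [y [Hu xE Ry]]]]; exists (lperm_comp g h), (u * t)%g, y.
split; first exact: (cover_comp cov).
  by move=> i /=; rewrite (val_witness_act _ Ht) xE permM.
by rewrite /= prelK.
Qed.

Lemma witness_act_fun g t n (F : fun_symbol L n) x z : H g t ->
  fun_of witness F x z ->
  fun_of witness (pfun g F) (witness_act t \o x) (witness_act t z).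
Proof.
move=> Ht [h [u [y [w [Hu xE zE Fy]]]]].
exists (lperm_comp g h), (u * t)%g, y, w; split.
- exact: (cover_comp cov).
- by move=> i /=; rewrite (val_witness_act _ Ht) xE permM.
- by rewrite (val_witness_act _ Ht) zE permM.
- by rewrite /= pfunK.
Qed.

Lemma witness_aut_automorphism g t : H g t -> is_automorphism G (witness_aut g t).
Proof.
move=> Ht; have Hu := cover_inv cov Ht.
have tK n (x : 'I_n -> witness) : witness_act t^-1%g \o (witness_act t \o x) = x.
  by apply/funext => i /=; rewrite (witness_actK Ht).
split; last first.
  exists (witness_act t^-1%g) => x /=; first exact: (witness_actK Ht).
  exact: (witness_actVK Ht).
apply: embeddingP => /=.
- exact: (cover_group cov Ht).
- exact: can_inj (witness_actK Ht).
- move=> n R x; split; first exact: (@witness_act_rel _ _ _ R).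
  by move/(witness_act_rel Hu); rewrite tK [prel _ _](prelK g R).
- move=> n F x; apply/seteqP; split=> [_ [y Fy <-]|z Fz].
    exact: (@witness_act_fun _ _ _ F).
  exists (witness_act t^-1%g z); last exact: (witness_actVK Ht).
  by have := witness_act_fun Hu Fz; rewrite tK [pfun _ _](pfunK g F).
Qed.

(** A tuple of the base chart may get a relation, or values of a function, from
    another chart.  As overlaps are closed partial isomorphisms, these are the
    ones that it has in A. *)
Lemma witness_embedP : is_embedding G witness_embed.
Proof.
have [t [Ht tE]] := identity_chart.
apply: embeddingP; first exact: pg_id.
- by move=> x y /(congr1 val) /(cover_inj cov).
- move=> n R x; split=> [Rx|[g [u [y [Hu yE Ry]]]]].
    by exists (lperm_id L), t, x; split=> // i; rewrite /= tE.
  have [s [s1 [s2 _]]] := cover_overlap cov Hu.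
  have xE : x = s \o y by apply/funext => i; exact/s1/esym/yE.
  rewrite xE -[R](prelVK g); apply: (proj1 (s2 _ _ y _) Ry) => i.
  by rewrite inE -yE /= xE.
- move=> n F x; apply/seteqP; split=> [_ [z Fz <-]|].
    by exists (lperm_id L), t, x, z; split=> // [i|]; rewrite /= tE.
  move=> z [g [u [y [w [Hu yE zE Fw]]]]].
  have [s [s1 [_ s2]]] := cover_overlap cov Hu.
  have xE : x = s \o y by apply/funext => i; exact/s1/esym/yE.
  have ys i : y i \in [set a | u (phi a) == phi (s a)] by rewrite inE -yE /= xE.
  have [i iE] := unary_index F.
  have wcl : w \in hull I (y i).
    apply: (@hull_closed _ _ _ _ n (pfunV g F) y _ w Fw) => j.
    by rewrite (iE j) mem_hull.
  have [v wv] := clov Hu (esym (yE i)) wcl.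
  exists v; last by apply: val_inj; rewrite /= zE wv.
  rewrite xE -[F](pfunVK g) -s2 //; exists w => //.
  by rewrite (s1 _ _ wv).
Qed.

Definition closed_set (S : set witness) : Prop :=
  forall n (F : fun_symbol L n) (x : 'I_n -> witness),
    (forall i, S (x i)) -> (fun_of witness F x `<=` S)%classic.

(** By unarity, each value of a function is in the closure of one point. *)
Lemma chart_closed g t : H g t ->
  closed_set [set z | exists v, val z = t (phi v)]%classic.
Proof.
move=> Ht n F x xt z [h [u [y [w [Hu yE zE Fw]]]]].
have [i iE] := unary_index F; have [v xv] := xt i.
have wcl : w \in hull I (y i).
  apply: (@hull_closed _ _ _ _ n (pfunV h F) y _ w Fw) => j.
  by rewrite (iE j) mem_hull.
have e : (u * t^-1)%g (phi (y i)) = phi v by rewrite permM -yE xv permK.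
have [v' e'] := clov (cover_comp cov Hu (cover_inv cov Ht)) e wcl.
by exists v'; rewrite zE -e' permM permKV.
Qed.

Definition witness_hull (w : witness) : set witness :=
  [set z | forall S, closed_set S -> S w -> S z]%classic.

(** The statement concerns structures embedded in the witness rather than its
    substructures, so that it applies both to faithfulness and to the induction
    that places the witness in the class. *)
Section Irreducible.
Variables (C : structure L) (e : smap C witness).
Hypothesis eE : is_embedding G e.

Lemma avoiding_closed (c : C) n (F : fun_symbol L n) (x : 'I_n -> C) :
  (forall i, ~ witness_hull (vpart e (x i)) (vpart e c)) ->
  (fun_of C F x `<=` [set w | ~ witness_hull (vpart e w) (vpart e c)])%classic.
Proof.
move=> xc z Fz zc; have [i iE] := unary_index F; apply: (xc i) => S clS Sx.
apply: zc => //; have [_ _ _ eF] := eE.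
apply: (clS n (pfun (lpart e) F) (vpart e \o x)).
  by move=> j; rewrite (iE j).
by rewrite -eF; exists z.
Qed.

Definition avoiding (c : C) : substructure C :=
  Substructure (@avoiding_closed c).

Lemma avoiding2_closed (c d : C) n (F : fun_symbol L n) (x : 'I_n -> C) :
  (forall i, (sub_set (avoiding c) `&` sub_set (avoiding d))%classic (x i)) ->
  (fun_of C F x `<=` sub_set (avoiding c) `&` sub_set (avoiding d))%classic.
Proof.
by move=> xcd z Fz; split; apply: (sub_closed _ Fz) => i; have [] := xcd i.
Qed.

Definition avoiding2 (c d : C) : substructure C :=
  Substructure (@avoiding2_closed c d).

(** Suppose that c and d share no chart.  No point has both in its closure and
    no related tuple has members whose closures contain c and d respectively,
    since charts are closed and contain the related tuples.  So the points whose
    closure avoids c and those whose closure avoids d form a free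
    decomposition of C, proper because it separates c from d. *)
Lemma irreducible_charted : irreducible G C ->
  charted H phi [set b : B | `[< exists c, val (vpart e c) = b >]].
Proof.
move=> irr; apply: conf => x y; rewrite inE => /asboolP[c cx].
rewrite inE => /asboolP[d dy].
apply: contrapT => nchart; apply: irr.
have sep g t : H g t -> (exists v, val (vpart e c) = t (phi v)) ->
    (exists v, val (vpart e d) = t (phi v)) -> False.
  move=> Ht [v cv] [w dw]; apply: nchart; exists g, t; split=> //.
  rewrite -cx -dy cv dw; apply/fintype.subsetP => b /set2P[] ->; exact: imset_f.
have cl1 : (sub_set (avoiding2 c d) `<=` sub_set (avoiding c))%classic.
  by move=> w [].
have cl2 : (sub_set (avoiding2 c d) `<=` sub_set (avoiding d))%classic.
  by move=> w [].
have hull_chart g t w z : H g t -> (exists v, val w = t (phi v)) ->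
    witness_hull w z -> exists v, val z = t (phi v).
  by move=> Ht wt zw; exact: (zw _ (chart_closed Ht) wt).
have range_incl (S : substructure C) : range (vpart (inclusion S)) = sub_set S.
  apply/seteqP; split=> [_ [z _ <-]|z Sz]; first exact: set_mem (valP z).
  by exists (SigSub (mem_set Sz)).
exists (avoiding c), (avoiding d), (avoiding2 c d), cl1, cl2; split.
- move=> full; have : sub_set (avoiding c) c by rewrite full.
  by apply=> S _.
- move=> full; have : sub_set (avoiding d) d by rewrite full.
  by apply=> S _.
split.
- split; first by split; [exact: inclusion_embedding|exact: inclusion_embedding|].
  by rewrite !range_incl.
- rewrite !range_incl; apply/seteqP; split=> // w _.
  apply: contrapT => /not_orP[/contrapT wc /contrapT wd].
  have /asboolP[g [t [v [Ht wv]]]] := valP (vpart e w).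
  by apply: (sep g t Ht); apply: (hull_chart g t (vpart e w)) => //; exists v.
move=> n k [i [w1 w1n w1k]] [j [w2 w2n w2k]].
have xd : witness_hull (vpart e (k i)) (vpart e d).
  apply: contrapT => no; apply: w1n.
  have cd : sub_set (avoiding2 c d) (k i).
    by split=> //; rewrite -w1k; exact: set_mem (valP w1).
  by exists (SigSub (mem_set cd)) => //; apply: val_inj; rewrite /= -w1k.
have xc : witness_hull (vpart e (k j)) (vpart e c).
  apply: contrapT => no; apply: w2n.
  have cd : sub_set (avoiding2 c d) (k j).
    by split=> //; rewrite -w2k; exact: set_mem (valP w2).
  by exists (SigSub (mem_set cd)) => //; apply: val_inj; rewrite /= -w2k.
split=> [R|F].
  have [_ _ eR _] := eE; move=> /eR[g [t [z [Ht zE _]]]].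
  apply: (sep g t Ht).
    by apply: (hull_chart g t (vpart e (k j))) => //; exists (z j); exact: zE.
  by apply: (hull_chart g t (vpart e (k i))) => //; exists (z i); exact: zE.
have /asboolP[g [t [v [Ht wv]]]] := valP (vpart e (k i)).
rewrite (unary_ord F j i) in xc.
by case: (sep g t Ht); apply: (hull_chart g t (vpart e (k i))) => //; exists v.
Qed.

End Irreducible.
End Witness.

(** * Coherent extension in the glued structure *)

Section WitnessEPPA.
Variables (L : language) (G : perm_group L).
Hypothesis L_unary : forall n, fun_symbol L n -> n = 1%N.
Variables (V : finType) (I : interpretation L V).
Variables (B : finType) (H : lperm L -> {perm B} -> Prop) (phi : V -> B).
Variable hat : lperm L -> {set V} -> (V -> V) -> {perm B}.
Hypothesis cov : is_cover G I H phi hat.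
Hypotheses (conf : conformal H phi) (clov : closed_overlaps I H phi).

Let W := witness I H phi.
Let psi : V -> W := vpart (witness_embed cov).
Let M : substructure W := image_substructure (witness_embedP L_unary cov clov).

Lemma psi_inj : injective psi.
Proof. by move=> x y /(congr1 val)/(cover_inj cov). Qed.

Lemma in_source (m : M) : exists v, psi v = val m.
Proof. by have [v _ vm] := set_mem (valP m); exists v. Qed.

Definition vdom (D : substructure M) : {set V} :=
  [set v | `[< exists d : D, val (val d) = psi v >]].

(** Off the domain the value is arbitrary: only partial automorphisms up to
    equality on their domains matter. *)
Definition vmap (D E : substructure M) (f : smap D E) (v : V) : V :=
  odflt v [pick w | `[< exists d : D, val (val d) = psi v /\
                        val (val (vpart f d)) = psi w >]].

Lemma vmapE (D E : substructure M) (f : smap D E) (d : D) v :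
  val (val d) = psi v -> val (val (vpart f d)) = psi (vmap f v).
Proof.
move=> dv; rewrite /vmap; case: pickP => [w /asboolP[d' [d'v d'w]]|no].
  by rewrite /= -d'w; congr (val (val (vpart f _))); apply/val_inj/val_inj; rewrite dv d'v.
have [w wE] := in_source (val (vpart f d)).
by have /asboolP[] := no w; exists d.
Qed.

Lemma vdomP (D : substructure M) v :
  reflect (exists d : D, val (val d) = psi v) (v \in vdom D).
Proof. by rewrite inE; exact: asboolP. Qed.

Lemma vdom_lift (D : substructure M) n (x : 'I_n -> V) :
  (forall i, x i \in vdom D) ->
  exists d : 'I_n -> D, (fun i => val (val (d i))) = psi \o x.
Proof.
move=> xD; have /choice[d dE] : forall i, exists d : D, val (val d) = psi (x i).
  by move=> i; exact/vdomP.
by exists d; apply/funext.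
Qed.

Lemma vmap_imset (D E : substructure M) (f : smap D E) :
  is_iso G f -> vmap f @: vdom D = vdom E.
Proof.
move=> [_ [f' _ f'K]]; apply/setP => w; apply/imsetP/vdomP.
  by move=> [v /vdomP[d dv] ->]; exists (vpart f d); exact: vmapE.
move=> [e ew]; have [v vE] := in_source (val (f' e)).
exists v; first by apply/vdomP; exists (f' e).
by apply: psi_inj; rewrite -ew -(vmapE f (esym vE)) f'K.
Qed.

(** Restricting the structure twice, to the copy of A and then to D, and reading
    it back on V changes nothing but names. *)
Lemma vmap_partial_aut (D E : substructure M) (f : smap D E) :
  is_iso G f -> partial_aut G I (lpart f) (vdom D) (vmap f).
Proof.
move=> fiso; have [[[fG _ _] fI fR fF] _] := fiso.
have [_ _ pR pF] := witness_embedP L_unary cov clov.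
have compE n (x : 'I_n -> V) (d : 'I_n -> D) :
    (fun i => val (val (d i))) = psi \o x ->
    (fun i => val (val (vpart f (d i)))) = psi \o (vmap f \o x).
  move=> dE; apply/funext => i /=; apply: vmapE.
  exact: (congr1 (fun h => h i) dE).
have clD : closed_in I (vdom D).
  move=> n F x xD y Fy; have [d dE] := vdom_lift xD.
  have Fp : fun_of W F (psi \o x) (psi y).
    have : (psi @` fun_of I F x)%classic (psi y) by exists y.
    by rewrite (pF n F x).
  have pyM : sub_set M (psi y) by exists y.
  pose m : M := SigSub (mem_set pyM).
  have mD : sub_set D m.
    apply: (sub_closed (s := D) (F := F) (x := fun i => val (d i))).
      by move=> i; exact: set_mem (valP (d i)).
    by move: Fp; rewrite -dE.
  by apply/vdomP; exists (SigSub (mem_set mD)).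
split=> //.
- move=> v w /vdomP[d dv] /vdomP[d' d'w] e.
  have : vpart f d = vpart f d'.
    by do 2!apply: val_inj; rewrite (vmapE f dv) (vmapE f d'w) e.
  by move=> /fI dd'; apply: psi_inj; rewrite -dv -d'w dd'.
split=> n X x xD; have [d dE] := vdom_lift xD.
  have fdE := compE _ _ _ dE.
  rewrite (pR n X x) (pR n (prel (lpart f) X) (vmap f \o x)).
  rewrite -/psi -dE -fdE; exact: fR.
have fdE := compE _ _ _ dE.
(* Membership in F(x), read in V and in D; similarly for E below. *)
have DE z : fun_of I X x z <-> exists e : D, val (val e) = psi z /\ fun_of D X d e.
  have pz : fun_of I X x z <-> fun_of W X (psi \o x) (psi z).
    rewrite -(pF n X x); split=> [Xz|[y Xy /psi_inj <-] //]; by exists z.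
  rewrite pz -dE; split=> [Xz|[e [ez Xe]]]; last by rewrite -ez; exact: Xe.
  have zD : z \in vdom D by apply: (clD _ X x) => //; rewrite pz -dE.
  by have /vdomP[e ez] := zD; exists e; split=> //=; rewrite ez.
have EE z : fun_of I (pfun (lpart f) X) (vmap f \o x) z <->
    exists e : E, val (val e) = psi z /\ fun_of E (pfun (lpart f) X) (vpart f \o d) e.
  have pz : fun_of I (pfun (lpart f) X) (vmap f \o x) z <->
      fun_of W (pfun (lpart f) X) (psi \o (vmap f \o x)) (psi z).
    rewrite -(pF n _ (vmap f \o x)); split=> [Xz|[y Xy /psi_inj <-] //].
    by exists z.
  rewrite pz -fdE; split=> [Xz|[e [ez Xe]]]; last by rewrite -ez; exact: Xe.
  have zM : sub_set M (psi z) by exists z.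
  pose m : M := SigSub (mem_set zM).
  have mE : sub_set E m.
    apply: (sub_closed (s := E) (F := pfun (lpart f) X)
      (x := fun i => val (vpart f (d i)))) => //.
    by move=> i; exact: set_mem (valP (vpart f (d i))).
  by exists (SigSub (mem_set mE)).
apply/seteqP; split=> [_ [z /DE[e [ez Xe]] <-]|z /EE[e [ez]]].
  apply/EE; exists (vpart f e); split; first exact: vmapE.
  by rewrite -fF; exists e.
rewrite -fF => -[e' Xe' e'E]; have [w wE] := in_source (val e').
exists w; first by apply/DE; exists e'.
by apply: psi_inj; rewrite -ez -e'E; apply/esym/vmapE.
Qed.

Definition witness_hat (D E : substructure M) (f : smap D E) : smap W W :=
  witness_aut I H phi (lpart f) (hat (lpart f) (vdom D) (vmap f)).

Lemma witness_hat_ok (D E : substructure M) (f : smap D E) : is_iso G f ->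
  is_automorphism G (witness_hat f) /\ extends f (witness_hat f).
Proof.
move=> fiso; have pf := vmap_partial_aut fiso; have Ht := cover_hat cov pf.
split; first exact: (witness_aut_automorphism cov Ht).
split=> // d; have [v vd] := in_source (val d).
rewrite (vmapE f (esym vd)) -vd; apply: val_inj.
rewrite /= (val_witness_act cov _ Ht) /= (cover_hatE cov pf) //.
by apply/vdomP; exists d.
Qed.

Lemma witness_hat_comp (D E K : substructure M) (f : smap D E) (g : smap E K) :
  is_iso G f -> is_iso G g ->
  witness_hat (smap_comp g f) = smap_comp (witness_hat g) (witness_hat f).
Proof.
move=> fiso giso; have pf := vmap_partial_aut fiso.
have pg := vmap_partial_aut giso; have fE := vmap_imset fiso.
rewrite /witness_hat /witness_aut /smap_comp /=; congr SMap.
have eqm : {in vdom D, vmap (smap_comp g f) =1 vmap g \o vmap f}.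
  move=> v /vdomP[d dv]; apply: psi_inj.
  by rewrite -(vmapE (smap_comp g f) dv) /= (vmapE g (vmapE f dv)).
rewrite (cover_eq_hat cov _ eqm) (cover_hat_comp cov pf) fE //.
by apply/funext/(witness_act_comp cov (cover_hat cov pf) (cover_hat cov pg)).
Qed.

Lemma charted_carried (X : set W) :
  charted H phi [set b : B | `[< exists2 w, X w & val w = b >]] ->
  exists g t, H g t /\ (witness_act t @` X `<=` range psi)%classic.
Proof.
move=> [g [t [Ht /fintype.subsetP sub]]]; have Hu := cover_inv cov Ht.
exists (lperm_inv g), t^-1%g; split=> // _ [w Xw <-].
have /imsetP[v _ wv] : val w \in [set t (phi v) | v : V].
  by apply: sub; rewrite inE; apply/asboolP; exists w.
by exists v => //; apply: val_inj; rewrite /= (val_witness_act cov _ Hu) wv permK.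
Qed.

Lemma witness_isf_coherent : isf_coherent_eppa_witness G (source I) W.
Proof.
split; [exact: finite_finset|exact: finite_finset|].
exists (witness_embed cov), (witness_embedP L_unary cov clov); split.
- move=> D E f /witness_hat_ok fP; by exists (witness_hat f).
- exists witness_hat; split; first exact: witness_hat_ok.
  exact: witness_hat_comp.
- move=> C /(irreducible_charted L_unary cov conf clov
    (inclusion_embedding G C)) Cch.
  have [|g [t [Ht sub]]] := @charted_carried (sub_set C).
    move: Cch; rewrite (_ : finset _ = [set b : B |
      `[< exists2 w, sub_set C w & val w = b >]]) //.
    apply/setP => b; rewrite !inE; apply: asbool_equiv_eq; split.
      by move=> [c <-]; exists (val c) => //; exact: set_mem (valP c).
    by move=> [w Cw <-]; exists (SigSub (mem_set Cw)).
  by exists (witness_aut I H phi g t); split; first exact: (witness_aut_automorphism cov Ht).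
Qed.

Lemma embed_in_source (C : structure L) (e : smap C W) :
  is_embedding G e -> (forall c, exists v, vpart e c = psi v) ->
  exists e' : smap C (source I), is_embedding G e'.
Proof.
move=> [[eG _ _] eI eR eF] /choice[q qE].
have [_ _ pR pF] := witness_embedP L_unary cov clov.
have qC n (x : 'I_n -> C) : vpart e \o x = psi \o (q \o x).
  by apply/funext => i; exact: qE.
exists (@SMap L C (source I) (lpart e) q); apply: embeddingP => //=.
- by move=> c d qcd; apply: eI; rewrite !qE qcd.
- move=> n R x; rewrite eR qC; exact: (iff_sym (pR n (prel (lpart e) R) (q \o x))).
- move=> n F x; apply: (image_set_inj psi_inj).
  transitivity (vpart e @` fun_of C F x)%classic.
    by rewrite image_comp; apply: eq_imagel => c _; rewrite /= qE.
  rewrite eF qC; exact: (esym (pF n (pfun (lpart e) F) (q \o x))).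
Qed.

End WitnessEPPA.

(** * Free amalgamation and membership in the class *)

Section Main.
Variables (L : language) (G : perm_group L).
Hypothesis L_unary : forall n, fun_symbol L n -> n = 1%N.

(** Colouring has to precede closing: recolouring
    the points of a closure need not respect an overlap at the point that
    generates it. *)
Lemma cover_exists (V : finType) (I : interpretation L V) :
  finite_set (relabel_orbit G (source I)) ->
  exists (B : finType) (H : lperm L -> {perm B} -> Prop) (phi : V -> B) hat,
    [/\ is_cover G I H phi hat, conformal H phi & closed_overlaps I H phi].
Proof.
move=> /finite_enum[n [J [JI JR]]].
have [i0 Ji0] : exists i0, J i0 = I.
  have : relabel_orbit G (source I) I.
    by exists (lperm_id L); [exact: pg_id | case: (I)].
  by rewrite -JR => -[i0 _ <-]; exists i0.
have Jclosed g i : pg_set G g -> exists j, J j = relabel_interp g (J i).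
  move=> Gg; have : range J (J i) by exists i.
  rewrite JR => -[h Gh <-].
  have : relabel_orbit G (source I) (relabel_interp (lperm_comp g h) I).
    by exists (lperm_comp g h) => //; exact: pg_comp.
  by rewrite -JR => -[j _ jE]; exists j; exact: jE.
have cov := base_is_cover L_unary JI Ji0 Jclosed.
have cov' := coloured_is_cover cov.
do 4!eexists; split; first exact: (closed_is_cover cov').
  exact: (closed_conformal cov' (coloured_conformal cov)).
exact: (closed_overlap cov').
Qed.

Section FreeUniqueness.
Variables (C : structure L) (B1 B2 A : substructure C).
Variables (AB1 : (sub_set A `<=` sub_set B1)%classic).
Variables (AB2 : (sub_set A `<=` sub_set B2)%classic).
Hypothesis freeC : is_free_amalgamation G (inclusion2 AB1) (inclusion2 AB2)
  (inclusion B1) (inclusion B2).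
Variables (D : structure L) (b1 : smap B1 D) (b2 : smap B2 D).
Hypothesis freeD : is_free_amalgamation G (inclusion2 AB1) (inclusion2 AB2) b1 b2.

(** The amalgamating maps agree on the common part, hence glue to a map on C; both
    sides have nothing on tuples that mix the two parts. *)
Lemma free_amalgamation_unique : exists h : smap C D, is_iso G h.
Proof.
have [[_ strC] covC freeC'] := freeC.
have [[[b1E b2E bE] strD] covD freeD'] := freeD.
have [[b1G _ _] b1I b1R b1F] := b1E; have [_ b2I b2R b2F] := b2E.
have in12 c : sub_set B1 c \/ sub_set B2 c.
  have : [set: C]%classic c by [].
  by rewrite covC => -[[w _ <-]|[w _ <-]]; [left|right]; exact: set_mem (valP w).
have inA c : sub_set B1 c -> sub_set B2 c -> sub_set A c.
  move=> c1 c2.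
  have : (range (vpart (inclusion B1)) `&` range (vpart (inclusion B2)))%classic c.
    by split; [exists (SigSub (mem_set c1))|exists (SigSub (mem_set c2))].
  by rewrite strC => -[a _ <-]; exact: set_mem (valP a).
have onA a : vpart b1 (vpart (inclusion2 AB1) a) = vpart b2 (vpart (inclusion2 AB2) a).
  exact: (congr1 (fun m => vpart m a) bE).
have agree (w1 : B1) (w2 : B2) : val w1 = val w2 -> vpart b1 w1 = vpart b2 w2.
  move=> w12; have wA : sub_set A (val w1).
    by apply: inA; [|rewrite w12]; exact: set_mem (valP _).
  have := onA (SigSub (mem_set wA)); congr (vpart b1 _ = vpart b2 _);
    exact: val_inj.
have /choice[h hE] : forall c, exists d,
    (forall w : B1, val w = c -> vpart b1 w = d) /\
    (forall w : B2, val w = c -> vpart b2 w = d).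
  move=> c; case: (in12 c) => cB.
    exists (vpart b1 (SigSub (mem_set cB))); split=> w wc.
      by congr (vpart b1 _); exact: val_inj.
    by apply/esym/agree; rewrite wc.
  exists (vpart b2 (SigSub (mem_set cB))); split=> w wc; first exact: agree.
  by congr (vpart b2 _); exact: val_inj.
have h1 (w : B1) : h (val w) = vpart b1 w by have [/(_ w erefl)] := hE (val w).
have h2 (w : B2) : h (val w) = vpart b2 w by have [_ /(_ w erefl)] := hE (val w).
have lift (S : substructure C) n (x : 'I_n -> C) : (forall i, sub_set S (x i)) ->
    exists y : 'I_n -> S, x = val \o y.
  by move=> xS; exists (fun i => SigSub (mem_set (xS i))).
have eqrel n (R : rel_symbol L n) : prel (lpart b1) R = prel (lpart b2) R.
  exact: (congr1 (fun m => prel (lpart m) R) bE).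
have eqfun n (F : fun_symbol L n) : pfun (lpart b1) F = pfun (lpart b2) F.
  exact: (congr1 (fun m => pfun (lpart m) F) bE).
(* Either a tuple lies in one part, or it has members strictly in both and is
   then bare in C and in D. *)
have mixed n (x : 'I_n -> C) :
    [\/ exists y : 'I_n -> B1, x = val \o y, exists y : 'I_n -> B2, x = val \o y
      | ((forall R : rel_symbol L n, ~ rel_of C R x) /\
         (forall F : fun_symbol L n, fun_of C F x = set0)) /\
        ((forall R : rel_symbol L n, ~ rel_of D R (h \o x)) /\
         (forall F : fun_symbol L n, fun_of D F (h \o x) = set0))].
  have [/lift|/existsNP[j xj]] := pselect (forall i, sub_set B1 (x i)).
    by constructor 1.
  have [/lift|/existsNP[i xi]] := pselect (forall i, sub_set B2 (x i)).
    by constructor 2.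
  have xi1 : sub_set B1 (x i) by case: (in12 (x i)).
  have xj2 : sub_set B2 (x j) by case: (in12 (x j)).
  pose wi : B1 := SigSub (mem_set xi1); pose wj : B2 := SigSub (mem_set xj2).
  have wiA : ~ range (vpart (inclusion2 AB1)) wi.
    move=> [a _ /(congr1 val) /= e]; apply: xi; rewrite -e.
    by apply: AB2; exact: set_mem (valP a).
  have wjA : ~ range (vpart (inclusion2 AB2)) wj.
    move=> [a _ /(congr1 val) /= e]; apply: xj; rewrite -e.
    by apply: AB1; exact: set_mem (valP a).
  constructor 3; split.
    by apply: freeC'; [exists i; exists wi|exists j; exists wj].
  apply: freeD'; [exists i; exists wi|exists j; exists wj] => //=.
    by rewrite -h1.
  by rewrite -h2.
have hI : injective h.
  have cross c d : sub_set B1 c -> sub_set B2 d -> h c = h d -> sub_set A c.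
    move=> c1 d2 cd.
    have : (range (vpart b1) `&` range (vpart b2))%classic (h c).
      split; [exists (SigSub (mem_set c1))|exists (SigSub (mem_set d2))] => //.
        by rewrite -h1.
      by rewrite -h2.
    rewrite strD => -[a _ /= ac].
    have /b1I/(congr1 val)/= <- : vpart b1 (vpart (inclusion2 AB1) a) =
        vpart b1 (SigSub (mem_set c1)) by rewrite -[RHS]h1.
    exact: set_mem (valP a).
  have I1 c d : sub_set B1 c -> sub_set B1 d -> h c = h d -> c = d.
    move=> c1 d1; rewrite (h1 (SigSub (mem_set c1))) (h1 (SigSub (mem_set d1))).
    by move=> /b1I/(congr1 val).
  have I2 c d : sub_set B2 c -> sub_set B2 d -> h c = h d -> c = d.
    move=> c2 d2; rewrite (h2 (SigSub (mem_set c2))) (h2 (SigSub (mem_set d2))).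
    by move=> /b2I/(congr1 val).
  move=> c d cd; case: (in12 c) (in12 d) => [c1|c2] [d1|d2].
  - exact: I1.
  - by apply: I2 => //; apply/AB2/(cross c d).
  - by apply: I2 => //; apply/AB2/(cross d c).
  - exact: I2.
exists (SMap (lpart b1) h); split; last first.
  apply: inj_surj_bijective => //= d.
  have : [set: D]%classic d by [].
  by rewrite covD => -[[w _ <-]|[w _ <-]]; exists (val w).
apply: embeddingP => //= [n R x|n F x].
- have [[y ->]|[y ->]|[[xC _] [xD _]]] := mixed n x; last first.
  + by split=> [/xC|/xD].
  + have -> : h \o (val \o y) = vpart b2 \o y by apply/funext => i; exact: h2.
    by rewrite eqrel; exact: (b2R n R y).
  + have -> : h \o (val \o y) = vpart b1 \o y by apply/funext => i; exact: h1.
    exact: (b1R n R y).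
- have [[y ->]|[y ->]|[[_ xC] [_ xD]]] := mixed n x; last first.
  + by rewrite xC xD image_set0.
  + have -> : h \o (val \o y) = vpart b2 \o y by apply/funext => i; exact: h2.
    rewrite eqfun -(b2F n F y); have [_ _ _ incF] := inclusion_embedding G B2.
    by rewrite -[fun_of C F _](incF n F y) image_comp; apply: eq_imagel => w _; exact: h2.
  + have -> : h \o (val \o y) = vpart b1 \o y by apply/funext => i; exact: h1.
    rewrite -(b1F n F y); have [_ _ _ incF] := inclusion_embedding G B1.
    by rewrite -[fun_of C F _](incF n F y) image_comp; apply: eq_imagel => w _; exact: h1.
Qed.

End FreeUniqueness.

Section Membership.
Variable K : structure L -> Prop.
Hypothesis HK : free_amalgamation_class G K.
Variables (V : finType) (I : interpretation L V).
Variables (B : finType) (H : lperm L -> {perm B} -> Prop) (phi : V -> B).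
Variable hat : lperm L -> {set V} -> (V -> V) -> {perm B}.
Hypothesis cov : is_cover G I H phi hat.
Hypotheses (conf : conformal H phi) (clov : closed_overlaps I H phi).
Hypothesis KV : K (source I).

Let W := witness I H phi.

Definition trace (C : structure L) (e : smap C W) : {set B} :=
  [set b : B | `[< exists c, val (vpart e c) = b >]].

(** Induction on the number of points: an irreducible structure sits in a chart
    and so embeds in the member A of the class, and any other one is the
    free amalgamation of two smaller structures, already in the class. *)
Lemma class_of_embedded (C : structure L) (e : smap C W) :
  is_embedding G e -> K C.
Proof.
have [[_ isoK herK _ _] freeK] := HK.
move: {2}#|trace e|.+1 (ltnSn #|trace e|) => n.
elim: n C e => // n IH C e ltn eE.
have [irr|] := pselect (irreducible G C).
  have [g [t [Ht /fintype.subsetP sub]]] :=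
    irreducible_charted L_unary cov conf clov eE irr.
  have Hu := cover_inv cov Ht.
  have aE := (witness_aut_automorphism cov Hu).1.
  have [|e' e'E] := embed_in_source (cov := cov) L_unary clov (embedding_comp eE aE).
    move=> c; have /imsetP[v _ cv] : val (vpart e c) \in [set t (phi v) | v : V].
      by apply: sub; rewrite inE; apply/asboolP; exists c.
    by exists v; apply: val_inj; rewrite /= (val_witness_act cov _ Hu) cv permK.
  exact: herK e'E KV.
move=> /contrapT[B1 [B2 [A [AB1 [AB2 [B1p B2p free]]]]]].
have sub_trace (S : substructure C) : (trace (smap_comp e (inclusion S)) \subset trace e).
  apply/fintype.subsetP => b; rewrite inE => /asboolP[c <-].
  by rewrite inE; apply/asboolP; exists (val c).
have proper (S : substructure C) : proper_substructure S ->
    #|trace (smap_comp e (inclusion S))| < n.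
  move=> Sp; rewrite -ltnS; apply: leq_trans _ ltn; rewrite ltnS.
  apply: proper_card; rewrite properE sub_trace; apply/negP => /fintype.subsetP full.
  apply: Sp; apply/seteqP; split=> // c _.
  have : val (vpart e c) \in trace e by rewrite inE; apply/asboolP; exists c.
  move=> /full; rewrite inE => /asboolP[s /val_inj es].
  have [_ eI _ _] := eE; rewrite -(eI _ _ es); exact: set_mem (valP s).
have KS (S : substructure C) : proper_substructure S -> K S.
  move=> Sp; apply: (IH S (smap_comp e (inclusion S)) (proper S Sp)).
  exact: embedding_comp (inclusion_embedding G S) eE.
have incl2 (S T : substructure C) (ST : (sub_set S `<=` sub_set T)%classic) :
    is_embedding G (inclusion2 ST).
  have [_ incI incR incF] := inclusion_embedding G S.
  have [_ _ _ incF'] := inclusion_embedding G T.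
  apply: embeddingP => //=; first exact: pg_id.
  move=> k F x; apply: (image_set_inj (f := val : T -> C)); first exact: val_inj.
  rewrite image_comp.
  exact: etrans (incF k F x) (esym (incF' k F (subfun ST \o x))).
have [D [b1 [b2 [KD freeD]]]] := freeK A B1 B2 (inclusion2 AB1) (inclusion2 AB2)
  (herK _ _ _ (incl2 _ _ AB1) (KS _ B1p)) (KS _ B1p) (KS _ B2p)
  (incl2 _ _ _) (incl2 _ _ _).
have [h [hE _]] := free_amalgamation_unique free freeD.
exact: herK hE KD.
Qed.

Lemma class_witness : K W.
Proof.
apply: (@class_of_embedded W (SMap (lperm_id L) id)).
apply: embeddingP => //=; first exact: pg_id.
by move=> n F x; rewrite image_id.
Qed.

End Membership.

Lemma isf_witness_transfer (A A' B : structure L) (h : smap A A') :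
  finite_structure A -> is_iso G h ->
  isf_coherent_eppa_witness G A' B -> isf_coherent_eppa_witness G A B.
Proof.
move=> finA [hE [h' hK h'K]] [_ finB [psi [psiE psiP]]]; split=> //.
have cE := embedding_comp hE psiE.
exists (smap_comp psi h), cE.
suff -> : image_substructure cE = image_substructure psiE by [].
have sE : range (vpart (smap_comp psi h)) = range (vpart psi).
  apply/seteqP; split=> [_ [x _ <-]|_ [x _ <-]]; first by exists (vpart h x).
  by exists (h' x) => //=; rewrite h'K.
rewrite /image_substructure; move: (range_closed cE) (range_closed psiE).
by rewrite sE => c1 c2; congr Substructure; exact: Prop_irrelevance.
Qed.

(** Covers are built over a finite type of vertices. *)
Lemma finite_structure_copy (A : structure L) : finite_structure A ->
  exists n (I : interpretation L 'I_n) (h : smap A (source I)), is_iso G h.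
Proof.
move=> /finite_enum_type[n [e [e' eK e'K]]].
pose I : interpretation L 'I_n := Interpretation
  (fun k R x => rel_of A R (e \o x))
  (fun k F x => (e @^-1` fun_of A F (e \o x))%classic).
exists n, I, (@SMap L A (source I) (lperm_id L) e'); split; last by exists e.
have xE k (x : 'I_k -> A) : e \o (e' \o x) = x by apply/funext => i /=; rewrite e'K.
apply: embeddingP => //=; first exact: pg_id.
- exact: can_inj e'K.
- by move=> k R x; rewrite xE.
- move=> k F x; rewrite xE; apply/seteqP; split=> [_ [y Fy <-]|y Fy].
    by rewrite /preimage /= e'K.
  by exists (e y) => //; rewrite eK.
Qed.

Lemma empty_closed (B : structure L) n (F : fun_symbol L n) (x : 'I_n -> B) :
  (forall i, (set0 : set B) (x i)) -> (fun_of B F x `<=` set0)%classic.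
Proof. by have n1 := L_unary F; subst n => /(_ ord0). Qed.

Definition empty_substructure (B : structure L) : substructure B :=
  Substructure (@empty_closed B).

(** Every language part occurs in a partial automorphism. *)
Lemma empty_iso (B : structure L) g : pg_set G g ->
  is_iso G (SMap g id : smap (empty_substructure B) (empty_substructure B)).
Proof.
have no (x : empty_substructure B) : False by exact: (set_mem (valP x)).
move=> Gg; split; last by exists id.
apply: embeddingP => //= n X x.
  have : 0 < n by case: n X {x} => // /rel_arity_gt0.
  by case: n X x => // n X x _; case: (no (x ord0)).
by case: (no (x (Ordinal (_ : 0 < n)))); rewrite (L_unary X).
Qed.

(** Let p be the language part of psi.  An automorphism of B with language part
    g p^-1 exists because it extends an empty map; composing psi with its vertex
    part q exhibits the relabelling of A by g as the pull-back of B along a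
    function A -> B, with no further relabelling. *)
Lemma eppa_finite_orbit (A B : structure L) :
  eppa_witness G A B -> finite_set (relabel_orbit G A).
Proof.
move=> [/finite_enum_type[a [ea [ea' eaK ea'K]]]
        /finite_enum_type[b [eb [eb' ebK eb'K]]] [psi [psiE wit]]].
pose pull (q : A -> B) : interpretation L A := Interpretation
  (fun n R x => rel_of B R (q \o x))
  (fun n F x => (q @^-1` fun_of B F (q \o x))%classic).
(* Functions from A to B, up to enumerations of the two vertex sets. *)
pose code (w : {ffun 'I_a -> 'I_b}) := pull (fun x => eb (w (ea' x))).
apply: (sub_finite_set (B := range code)); last first.
  by apply: finite_image; exact: finite_finset.
move=> _ [g Gg <-].
have [[pG _ _] pI pR pF] := psiE.
have Gk : pg_set G (lperm_comp g (lperm_inv (lpart psi))).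
  by apply: pg_comp => //; exact: pg_inv.
have [t [[[[_ _ _] tI tR tF] _] [tL _]]] := wit _ _ _ (empty_iso _ Gk).
exists [ffun i => eb' (vpart t (vpart psi (ea i)))] => //.
rewrite /code (_ : (fun x => _) = vpart t \o vpart psi); last first.
  by apply/funext => x; rewrite ffunE ea'K eb'K.
rewrite /pull /= /relabel_interp /=; congr Interpretation.
  apply: functional_extensionality_dep => n; apply/funext => R; apply/funext => x.
  apply/propext; rewrite (pR n (prelV g R) x) (tR n _ (vpart psi \o x)) tL /=.
  by rewrite prelK prelVK.
apply: functional_extensionality_dep => n; apply/funext => F; apply/funext => x.
have qE : ((vpart t \o vpart psi) @` fun_of A (pfunV g F) x)%classic =
    fun_of B F ((vpart t \o vpart psi) \o x).
  by rewrite -image_comp pF tF tL /= pfunK pfunVK.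
apply/seteqP; split=> [y|y Fy]; rewrite /preimage /= -qE.
  by move=> [z Fz /tI/pI <-].
by exists y.
Qed.

End Main.

Theorem corollary1p4 (L : language) (G : perm_group L)
    (L_unary : forall n, fun_symbol L n -> n = 1%N)
    (K : structure L -> Prop) (HK : free_amalgamation_class G K) :
  (has_eppa G K <-> (forall A, K A -> finite_set (relabel_orbit G A))) /\
  (has_eppa G K -> has_isf_coherent_eppa G K).
Proof.
have [[finK isoK _ _ _] _] := HK.
have orbit : has_eppa G K -> forall A, K A -> finite_set (relabel_orbit G A).
  move=> eppa A /eppa[B [_ wit]]; exact: eppa_finite_orbit wit.
have isf : (forall A, K A -> finite_set (relabel_orbit G A)) ->
    has_isf_coherent_eppa G K.
  move=> orb A KA; have [n [I [h hiso]]] := finite_structure_copy G (finK A KA).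
  have KI := isoK _ _ _ hiso KA.
  have [B [H [phi [hat [cov conf clov]]]]] := cover_exists L_unary (orb _ KI).
  exists (witness I H phi); split.
    exact: (class_witness L_unary HK cov conf clov KI).
  apply: isf_witness_transfer (finK A KA) hiso _.
  exact: (witness_isf_coherent L_unary cov conf clov).
split; last by move=> /orbit/isf.
split=> // /isf eppa A /eppa[B [KB [finA finB [psi [psiE [wit _ _]]]]]].
by exists B; split=> //; split=> //; exists psi, psiE.
Qed.
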